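(* (In Internal Set Theory.) Let $d$ be a standard positive integer, let $x_0\in\mathbb{R}^d$ be standard and let $F:\mathbb{R}_+\times\mathbb{R}^d\to\mathbb{R}^d$ be a standard and continuous function. Let $I$ be a subset of $\mathbb{R}$ with $0\in I$ and let $x:I\to\mathbb{R}^d$ be a function with $x(0)\simeq x_0$. Suppose that: (a) the function $x$ satisfies the $F$-stroboscopic property; (b) the initial value problem $\dot y(t)=F(t,y(t))$, $y(0)=x_0$, has a unique solution $y$; let $J=[0,\omega)$, $0<\omega\le\infty$, be its maximal positive interval of definition. Then, for every standard $L\in J$, $[0,L]\subset I$ and $x(t)\simeq y(t)$ for all $t\in[0,L]$.
   Context: We work in Nelson's Internal Set Theory (IST): ZFC with an additional unary predicate ''standard'' and the axiom schemes of Idealization, Standardization and Transfer. Sets and functions are arbitrary (internal) objects of IST, not assumed standard unless stated. A real number is infinitesimal if its absolute value is less than every standard positive real, limited if its absolute value is at most some standard positive real, and unlimited otherwise. A vector of a standard normed space is infinitesimal (limited, unlimited) if its norm is; $x\simeq y$ means that $x-y$ is infinitesimal. $\mathbb{R}_+=[0,\infty)$. $F$-stroboscopic property: the function $x:I\to\mathbb{R}^d$ is said to satisfy it if there exists $\mu>0$ such that, for all limited $t\ge0$ in $I$ satisfying $[0,t]\subset I$ and $x(s)$ limited for all $s\in[0,t]$, there exists $t'\in I$ such that $\mu<t'-t\simeq0$, $[t,t']\subset I$, $x(s)\simeq x(t)$ for all $s\in[t,t']$, and $\frac{x(t')-x(t)}{t'-t}\simeq F(t,x(t))$. ($\mu$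 may be infinitesimal.) ''Unique solution'' means that there is exactly one maximal (non-continuable to the right) solution and every solution is a restriction of it. *)

(* Defs.v *)
From mathcomp Require Import all_boot all_order all_algebra.
From mathcomp Require Import boolp classical_sets constructive_ereal.

Set Implicit Arguments.
Unset Strict Implicit.
Unset Printing Implicit Defensive.
Import Order.TTheory GRing.Theory Num.Theory.

Local Open Scope classical_set_scope.
Local Open Scope ring_scope.

(* IST is a first-order theory, and a theorem of IST is a sentence that holds
  in all its models.  A model is a type with a membership relation and a
  predicate [st] ("standard").  The axiom schemes range over first-order
  formulas, so formulas are represented syntactically: allowing arbitrary
  Rocq predicates in (for instance) Transfer or Separation would be
  inconsistent with Idealization.  Everything outside the schemes
  (definitions and the final statement) is written directly with Rocq's
  connectives and quantifiers over the elements of the model. *)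

Record universe := Universe {
  carrier :> Type;
  elem : carrier -> carrier -> Prop;
  st : carrier -> Prop
}.

Notation "a ∈ b" := (elem a b) (at level 70, no associativity).

(* De Bruijn indices: variable 0 is bound by the innermost [FAll]. *)
Inductive formula :=
  | FEq of nat & nat
  | FMem of nat & nat
  | FSt of nat
  | FFalse
  | FImp of formula & formula
  | FAll of formula.

Fixpoint internal (p : formula) : bool :=
  match p with
  | FSt _ => false
  | FImp p q => internal p && internal q
  | FAll p => internal p
  | _ => true
  end.

Fixpoint free (n : nat) (p : formula) : bool :=
  match p with
  | FEq i j | FMem i j => (n == i) || (n == j)
  | FSt i => n == i
  | FFalse => false
  | FImp p q => free n p || free n q
  | FAll p => free n.+1 p
  end.

Definition env_cons (T : Type) (a : T) (e : nat -> T) (n : nat) : T :=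
  if n is m.+1 then e m else a.

Notation "a ;; e" := (env_cons a e) (at level 60, right associativity).

Fixpoint sat (U : universe) (e : nat -> U) (p : formula) : Prop :=
  match p with
  | FEq i j => e i = e j
  | FMem i j => e i ∈ e j
  | FSt i => st (e i)
  | FFalse => False
  | FImp p q => sat e p -> sat e q
  | FAll p => forall a : U, sat (a ;; e) p
  end.

Section Vocabulary.
Variable U : universe.
Implicit Types (a b f n z : U) (A B : set U).

Definition elts a : set U := [set z | z ∈ a].

(* An element satisfying P, with default value a if there is none. *)
Definition pick_or a (P : set U) : U :=
  if pselect (exists z, P z) is left h then projT1 (cid h) else a.

Definition upair a b : U :=
  pick_or a [set p | forall z, z ∈ p <-> z = a \/ z = b].

Definition opair a b : U := upair (upair a a) (upair a b).

Definition inductive_set a : Prop :=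
  (forall z, (forall w, ~ w ∈ z) -> z ∈ a) /\
  (forall n, n ∈ a ->
     forall s, (forall z, z ∈ s <-> z ∈ n \/ z = n) -> s ∈ a).

(* Von Neumann natural numbers: n = {0, ..., n-1}. *)
Definition is_nat n : Prop := forall a, inductive_set a -> n ∈ a.

(* Functions are sets of Kuratowski pairs.  A and B need not be extensions of
   elements of U, but the domain of an element f of U is one in a model of ZFC:
   if f is internal then so is its domain A. *)
Definition is_function A B f : Prop :=
  (forall p, p ∈ f -> exists a b, [/\ A a, B b & p = opair a b]) /\
  (forall a, A a -> exists! b, opair a b ∈ f).

Definition app f a : U := pick_or f [set b | opair a b ∈ f].

Definition is_bijection A B f : Prop :=
  is_function A B f /\ (forall b, B b -> exists! a, opair a b ∈ f).

Definition finite_elt z : Prop :=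
  exists n, is_nat n /\ exists f, is_bijection (elts n) (elts z) f.

End Vocabulary.

Record ZFC (U : universe) : Prop := {
  extensionality : forall a b : U, (forall z, z ∈ a <-> z ∈ b) -> a = b;
  foundation : forall a : U, (exists z, z ∈ a) ->
    exists2 z, z ∈ a & forall w, ~ (w ∈ z /\ w ∈ a);
  pairing : forall a b : U, exists p, forall z, z ∈ p <-> z = a \/ z = b;
  union : forall a : U, exists u, forall z, z ∈ u <-> exists2 w, z ∈ w & w ∈ a;
  power : forall a : U, exists p, forall z, z ∈ p <-> forall w, w ∈ z -> w ∈ a;
  infinity : exists a : U, inductive_set a;
  choice : forall a : U,
    (forall x, x ∈ a -> exists z, z ∈ x) ->
    (forall x y, x ∈ a -> y ∈ a -> (exists z, z ∈ x /\ z ∈ y) -> x = y) ->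
    exists c, forall x, x ∈ a -> exists! z, z ∈ x /\ z ∈ c;
  separation : forall (p : formula) (e : nat -> U) (a : U), internal p ->
    exists b, forall z, z ∈ b <-> z ∈ a /\ sat (z ;; e) p;
  replacement : forall (p : formula) (e : nat -> U) (a : U), internal p ->
    (forall x y y', x ∈ a -> sat (x ;; y ;; e) p -> sat (x ;; y' ;; e) p ->
       y = y') ->
    exists b, forall y, y ∈ b <-> exists2 x, x ∈ a & sat (x ;; y ;; e) p
}.

Record IST (U : universe) : Prop := {
  IST_ZFC : ZFC U;
  transfer : forall (p : formula) (e : nat -> U), internal p ->
    (forall n, free n.+1 p -> st (e n)) ->
    (forall x, st x -> sat (x ;; e) p) -> forall x, sat (x ;; e) p;
  idealization : forall (p : formula) (e : nat -> U), internal p ->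
    (forall z, st z -> finite_elt z ->
       exists x, forall y, y ∈ z -> sat (x ;; y ;; e) p) <->
    (exists x, forall y, st y -> sat (x ;; y ;; e) p);
  standardization : forall (p : formula) (e : nat -> U) (a : U), st a ->
    exists b, st b /\
      forall z, st z -> (z ∈ b <-> z ∈ a /\ sat (z ;; e) p)
}.

(* The real numbers of a universe: a complete ordered field of the universe that is standard as a structure.
  Its elements are presented as a Rocq type [K], in bijection through [inU]
  with the elements of the set [Rset].  Completeness is required for the
  subsets that are elements of the universe (the internal ones) only. *)

Record real_system (U : universe) := RealSystem {
  K :> realFieldType;
  inU : K -> U;
  Rset : U;
  inU_inj : injective inU;
  RsetP : elts Rset = range inU;
  Rset_st : st Rset;
  addK_st : exists2 g : U, st g &
    elts g = [set u | exists x y, u = opair (opair (inU x) (inU y)) (inU (x + y))];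
  mulK_st : exists2 g : U, st g &
    elts g = [set u | exists x y, u = opair (opair (inU x) (inU y)) (inU (x * y))];
  leK_st : exists2 g : U, st g &
    elts g = [set u | exists x y, x <= y /\ u = opair (inU x) (inU y)];
  Dedekind : forall a : U, let A := [set x | inU x ∈ a] in
    has_sup A -> supremums A !=set0
}.

Section Analysis.
Variables (U : universe) (R : real_system U).
Implicit Types (x t : R) (v w f y F : U) (D : set R).

Definition standard x : Prop := st (inU x).
Definition infinitesimal x : Prop := forall e, standard e -> 0 < e -> `|x| < e.
Definition limited x : Prop := exists e, [/\ standard e, 0 < e & `|x| <= e].

(* Elements of R^d are the functions d -> R of the universe, where
  d = {0, ..., d-1} is a natural number of the universe. *)

Variable d : U.

Definition vectors : set U := is_function (elts d) (range (@inU U R)).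

Definition coord v (i : U) : R := xget 0 [set a | inU a = app v i].

(* The max norm of the vector with coordinates c i, i < d. *)
Definition norm (c : U -> R) : R :=
  xget 0 [set r | (exists2 i, i ∈ d & `|c i| = r) /\
                  (forall i, i ∈ d -> `|c i| <= r)].

Definition dist v w : R := norm (fun i => coord v i - coord w i).

Definition vlimited v : Prop := limited (norm (coord v)).
Definition vnear v w : Prop := infinitesimal (dist v w).

(* Norm of (f(s) - f(t)) / (s - t) - v. *)
Definition slope_dist f (t s : R) v : R :=
  norm (fun i => (coord (app f (inU s)) i - coord (app f (inU t)) i) / (s - t)
                 - coord v i).

Definition app2 F t v : U := app F (opair (inU t) v).

Definition is_field F : Prop :=
  is_function [set p | exists t v, [/\ 0 <= t, vectors v & p = opair (inU t) v]]
         vectors F.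

Definition continuous_field F : Prop :=
  forall t v, 0 <= t -> vectors v ->
  forall e : R, 0 < e -> exists2 h : R, 0 < h &
  forall t' v', 0 <= t' -> vectors v' ->
    `|t' - t| < h -> dist v' v < h -> dist (app2 F t' v') (app2 F t v) < e.

Definition stroboscopic F D f : Prop :=
  exists2 mu : R, 0 < mu &
  forall t : R, limited t -> 0 <= t -> D t ->
    (forall s, 0 <= s <= t -> D s) ->
    (forall s, 0 <= s <= t -> vlimited (app f (inU s))) ->
  exists2 t' : R, D t' &
    [/\ mu < t' - t, infinitesimal (t' - t),
        (forall s, t <= s <= t' -> D s),
        (forall s, t <= s <= t' -> vnear (app f (inU s)) (app f (inU t))) &
        infinitesimal (slope_dist f t t' (app2 F t (app f (inU t))))].

(* Solutions of y' = F(t, y), y(0) = v0 live on nondegenerate intervals D with minimum 0, open or closed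
  on the right, bounded or not; derivatives are relative to D (one-sided at the
  end points of D). *)

Definition solution F v0 D y : Prop :=
  [/\ [/\ D 0, (forall t, D t -> 0 <= t), (exists2 t, D t & 0 < t) &
          (forall a b c, D a -> D c -> a <= b <= c -> D b)],
      is_function (@inU U R @` D) vectors y,
      app y (inU (0 : R)) = v0 &
      forall t, D t -> forall e : R, 0 < e -> exists2 h : R, 0 < h &
        forall s, D s -> s != t -> `|s - t| < h ->
          slope_dist y t s (app2 F t (app y (inU t))) < e].

Definition restricts D y D' y' : Prop :=
  D `<=` D' /\ (forall t, D t -> app y (inU t) = app y' (inU t)).

Definition maximal_solution F v0 D y : Prop :=
  solution F v0 D y /\
  (forall D' y', solution F v0 D' y' -> restricts D y D' y' -> D' = D).

Definition unique_solution F v0 D y : Prop :=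
  [/\ maximal_solution F v0 D y,
      (forall D' y', maximal_solution F v0 D' y' -> D' = D /\ y' = y) &
      (forall D' y', solution F v0 D' y' -> restricts D' y' D y)].

End Analysis.

(* Main.v *)
(* Near a standard point (t0, v0) the field F is almost constant.  Hence, if x is near v0
  at a time near t0, then for a standard time x moves almost along the line of slope
  F(t0, v0): the times at which the strobed motion has stayed close to this line form
  an internal set, and since each strobe step is longer than mu, its supremum cannot
  stop the motion early.  It follows that x is S-continuous as long as it is limited, and
  that its shadow z, the standardization of the set of all (t, v) such that x is limited
  on [0, t] and v is near x(t), is a standard solution (derivatives are computed at
  standard times, then transferred).  By uniqueness z is a restriction of y.  If z were
  not defined at some standard L in J, let T be the supremum of its domain.  Then T is in
  J and z tends to y(T) at T; by Transfer y(T) is standard, and the local motion near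
  (T, y(T)) carries x past T, a contradiction. *)

Require Import Defs.
From mathcomp Require Import all_boot all_order all_algebra.
From mathcomp Require Import boolp classical_sets constructive_ereal.
From mathcomp Require Import ring lra.

Set Implicit Arguments.
Unset Strict Implicit.
Unset Printing Implicit Defensive.
Import Order.TTheory GRing.Theory Num.Theory.

Local Open Scope classical_set_scope.
Local Open Scope ring_scope.

(** * Definability *)

Fixpoint rename (r : nat -> nat) (p : formula) : formula :=
  match p with
  | FEq i j => FEq (r i) (r j)
  | FMem i j => FMem (r i) (r j)
  | FSt i => FSt (r i)
  | FFalse => FFalse
  | FImp p q => FImp (rename r p) (rename r q)
  | FAll p => FAll (rename (fun n => if n is k.+1 then (r k).+1 else 0%N) p)
  end.

Lemma internal_rename r p : internal (rename r p) = internal p.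
Proof. by elim: p r => //= p IHp q IHq r; rewrite IHp IHq. Qed.

Lemma sat_rename (U : universe) (e : nat -> U) r p :
  sat e (rename r p) <-> sat (fun n => e (r n)) p.
Proof.
elim: p e r => //= [p IHp q IHq|p IHp] e r; first by rewrite IHp IHq.
have E a : (fun n => (a ;; e) (if n is k.+1 then (r k).+1 else 0%N)) =
    a ;; (fun n => e (r n)) by apply/funext; case.
by split => H a; have := H a; rewrite IHp E.
Qed.

(* The axiom scheme in which a definable predicate is to be used: it determines whether
  the formula has to be internal and whether the constants in it have to be standard. *)
Inductive scheme := Transfer | Separation | Standardization.

Definition is_internal (m : scheme) : bool :=
  if m is Standardization then false else true.

(* Variables sit at even positions of the environment, constants at odd ones. *)
Definition interleave (T : Type) (e c : nat -> T) (n : nat) : T :=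
  if odd n then c n./2 else e n./2.

Lemma interleave_even (T : Type) (e c : nat -> T) n :
  interleave e c n.*2 = e n.
Proof. by rewrite /interleave odd_double doubleK. Qed.

Lemma interleave_odd (T : Type) (e c : nat -> T) n :
  interleave e c n.*2.+1 = c n.
Proof. by rewrite /interleave /= odd_double /= uphalf_double. Qed.

Section Definability.
Variable U : universe.
Implicit Types (m : scheme) (e c : nat -> U).

Definition admissible m (a : U) : Prop := if m is Transfer then st a else True.

Definition definable m (P : (nat -> U) -> Prop) : Prop :=
  exists p c, [/\ is_internal m -> internal p, forall n, admissible m (c n) &
    forall e, P e <-> sat (interleave e c) p].

Definition term m (f : (nat -> U) -> U) : Prop :=
  definable m (fun e => e 0%N = f (fun n => e n.+1)).

Lemma admissible_st m a : st a -> admissible m a.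
Proof. by case: m. Qed.

Lemma interleaved_rename e c (ve vc : nat -> nat) (e' c' : nat -> U) p :
  (forall n, interleave e' c' (ve n) = e n) ->
  (forall n, interleave e' c' (vc n) = c n) ->
  sat (interleave e' c')
      (rename (fun n => if odd n then vc n./2 else ve n./2) p) <->
  sat (interleave e c) p.
Proof.
move=> Ee Ec; rewrite sat_rename; suff -> : (fun n => interleave e' c'
  (if odd n then vc n./2 else ve n./2)) = interleave e c by [].
by apply/funext => n; rewrite [RHS]/interleave; case: ifP.
Qed.

Lemma definable_rename m (r : nat -> nat) (P : (nat -> U) -> Prop) :
  definable m P -> definable m (fun e => P (fun n => e (r n))).
Proof.
move=> [p [c [ip cc Pp]]].
exists (rename (fun n => if odd n then n./2.*2.+1 else (r n./2).*2) p), c.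
split=> [|//|e]; first by rewrite internal_rename.
rewrite Pp; symmetry.
by apply: (@interleaved_rename _ _ (fun n => (r n).*2) (fun n => n.*2.+1)) => n;
  rewrite ?interleave_even ?interleave_odd.
Qed.

Lemma definable_iff m (P P' : (nat -> U) -> Prop) :
  (forall e, P e <-> P' e) -> definable m P -> definable m P'.
Proof.
by move=> E [p [c [ip cc Pp]]]; exists p, c; split=> // e; rewrite -E.
Qed.

Lemma definable_imp m (P P' : (nat -> U) -> Prop) :
  definable m P -> definable m P' -> definable m (fun e => P e -> P' e).
Proof.
move=> [p [c [ip cc Pp]]] [p' [c' [ip' cc' Pp']]].
exists (FImp
  (rename (fun n => if odd n then n./2.*2.*2.+1 else n./2.*2) p)
  (rename (fun n => if odd n then n./2.*2.+1.*2.+1 else n./2.*2) p')).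
exists (interleave c c'); split=> [im|n|e] /=.
- by rewrite !internal_rename ip ?ip'.
- by rewrite /interleave; case: ifP.
have E1 := @interleaved_rename e c (fun n => n.*2) (fun n => n.*2.*2.+1)
  e (interleave c c') p.
have E2 := @interleaved_rename e c' (fun n => n.*2) (fun n => n.*2.+1.*2.+1)
  e (interleave c c') p'.
rewrite {}E1 ?{}E2 ?Pp ?Pp' // => n;
  by rewrite ?interleave_even ?interleave_odd ?interleave_even ?interleave_odd.
Qed.

Lemma definable_all m (P : U -> (nat -> U) -> Prop) :
  definable m (fun e => P (e 0%N) (fun n => e n.+1)) ->
  definable m (fun e => forall a, P a e).
Proof.
move=> [p [c [ip cc Pp]]].
exists (FAll (rename (fun n => if odd n then n./2.*2.+2
  else if n./2 is k.+1 then k.*2.+1 else 0%N) p)), c.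
split=> [im|//|e] /=; first by rewrite internal_rename ip.
suff E a : P a e <-> sat (a ;; interleave e c) (rename (fun n => if odd n
    then n./2.*2.+2 else if n./2 is k.+1 then k.*2.+1 else 0%N) p).
  by split=> H a; [rewrite -E|rewrite E].
have -> : P a e = P ((a ;; e) 0%N) (fun n => (a ;; e) n.+1).
  by congr P; apply/funext.
rewrite Pp sat_rename; suff -> : interleave (a ;; e) c = (fun n =>
  (a ;; interleave e c) (if odd n then n./2.*2.+2
    else if n./2 is k.+1 then k.*2.+1 else 0%N)) by [].
apply/funext => n; rewrite {1}/interleave; case: ifP => _ /=.
  by rewrite interleave_odd.
by case: n./2 => [|k] //=; rewrite interleave_even.
Qed.

Section Constants.
Variables (a0 : U) (a0_st : st a0).

Lemma definable_false m : definable m (fun=> False).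
Proof.
by exists FFalse, (fun=> a0); split=> // n; apply: admissible_st.
Qed.

Lemma definable_eqV m i j : definable m (fun e => e i = e j).
Proof.
exists (FEq i.*2 j.*2), (fun=> a0); split=> [//|n|e /=].
  exact: admissible_st.
by rewrite !interleave_even.
Qed.

Lemma definable_memV m i j : definable m (fun e => e i ∈ e j).
Proof.
exists (FMem i.*2 j.*2), (fun=> a0); split=> [//|n|e /=].
  exact: admissible_st.
by rewrite !interleave_even.
Qed.

Lemma definable_stV i : definable Standardization (fun e => st (e i)).
Proof.
by exists (FSt i.*2), (fun=> a0); split=> // e /=; rewrite !interleave_even.
Qed.

Lemma term_cst m a : admissible m a -> term m (fun=> a).
Proof.
move=> am; exists (FEq 0%N 1%N), (fun=> a); split=> // e /=.
Qed.

Lemma term_var m i : term m (fun e => e i).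
Proof. exact: definable_eqV. Qed.

Lemma definable_not m P : definable m P -> definable m (fun e => ~ P e).
Proof. by move=> dP; apply: definable_imp => //; apply: definable_false. Qed.

Lemma definable_and m P Q :
  definable m P -> definable m Q -> definable m (fun e => P e /\ Q e).
Proof.
move=> dP dQ; have := definable_not (definable_imp dP (definable_not dQ)).
apply: definable_iff => e; split=> [H|[? ?]]; last by auto.
by split; apply: contrapT => nH; apply: H => ? //.
Qed.

Lemma definable_or m P Q :
  definable m P -> definable m Q -> definable m (fun e => P e \/ Q e).
Proof.
move=> dP dQ; have := definable_imp (definable_not dP) dQ.
apply: definable_iff => e; split=> [H|[? ?|? ?]] //.
by have [|] := pselect (P e); [left|right; apply: H].
Qed.

Lemma definable_equiv m P Q :
  definable m P -> definable m Q -> definable m (fun e => P e <-> Q e).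
Proof. by move=> dP dQ; apply: definable_and; apply: definable_imp. Qed.

Lemma definable_ex m (P : U -> (nat -> U) -> Prop) :
  definable m (fun e => P (e 0%N) (fun n => e n.+1)) ->
  definable m (fun e => exists a, P a e).
Proof.
move=> dP; have := definable_not (@definable_all m (fun a e => ~ P a e)
  (definable_not dP)).
apply: definable_iff => e; split=> [H|[a Pa] /(_ a)] //.
by apply: contrapT => nex; apply: H => a Pa; apply: nex; exists a.
Qed.

Lemma definable_subst m (P : U -> (nat -> U) -> Prop) f :
  definable m (fun e => P (e 0%N) (fun n => e n.+1)) -> term m f ->
  definable m (fun e => P (f e) e).
Proof.
move=> dP tf.
have := @definable_ex m (fun a e => a = f e /\ P a e) (definable_and tf dP).
by apply: definable_iff => e; split=> [[a [-> ]]|Pf] //; exists (f e).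
Qed.

Lemma term_rename m (r : nat -> nat) f :
  term m f -> term m (fun e => f (fun n => e (r n))).
Proof.
move=> tf.
exact: (definable_rename (fun n => if n is k.+1 then (r k).+1 else 0%N) tf).
Qed.

Lemma definable_app1 m (P : U -> Prop) f :
  definable m (fun e => P (e 0%N)) -> term m f ->
  definable m (fun e => P (f e)).
Proof. by move=> dP tf; apply: (@definable_subst m (fun a _ => P a)). Qed.

Lemma definable_app2 m (P : U -> U -> Prop) f g :
  definable m (fun e => P (e 0%N) (e 1%N)) -> term m f -> term m g ->
  definable m (fun e => P (f e) (g e)).
Proof.
move=> dP tf tg; apply: (@definable_subst m (fun a e => P a (g e))) => //.
apply: (@definable_subst m (fun b e => P (e 0%N) b)); last exact: term_rename.
exact: (definable_rename (fun n => if n is k.+1 then 0%N else 1%N) dP).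
Qed.

Lemma definable_app3 m (P : U -> U -> U -> Prop) f g h :
  definable m (fun e => P (e 0%N) (e 1%N) (e 2%N)) ->
  term m f -> term m g -> term m h ->
  definable m (fun e => P (f e) (g e) (h e)).
Proof.
move=> dP tf tg th.
apply: (@definable_subst m (fun a e => P a (g e) (h e))) => //.
apply: (@definable_subst m (fun b e => P (e 0%N) b (h (fun n => e n.+1))));
  last exact: term_rename.
apply: (@definable_subst m (fun b e => P (e 1%N) (e 0%N) b)
  (fun e => h (fun n => e n.+2))).
  exact: (definable_rename
    (fun n => if n is k.+1 then if k is l.+1 then 0%N else 1%N else 2%N) dP).
exact: (@term_rename m (fun n => n.+2)).
Qed.

Lemma term_app1 m (f : U -> U) g :
  term m (fun e => f (e 0%N)) -> term m g -> term m (fun e => f (g e)).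
Proof.
move=> tf tg; apply: (@definable_app2 m (fun a b => a = f b)) => //.
  exact: term_var.
exact: (term_rename S).
Qed.

Lemma term_app2 m (f : U -> U -> U) g h :
  term m (fun e => f (e 0%N) (e 1%N)) -> term m g -> term m h ->
  term m (fun e => f (g e) (h e)).
Proof.
move=> tf tg th; apply: (@definable_app3 m (fun a b b' => a = f b b')) => //.
- exact: term_var.
- exact: (term_rename S).
- exact: (term_rename S).
Qed.

Lemma definable_eq m f g :
  term m f -> term m g -> definable m (fun e => f e = g e).
Proof. by apply: definable_app2; apply: definable_eqV. Qed.

Lemma definable_mem m f g :
  term m f -> term m g -> definable m (fun e => f e ∈ g e).
Proof. by apply: definable_app2; apply: definable_memV. Qed.

Lemma definable_st f :
  term Standardization f -> definable Standardization (fun e => st (f e)).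
Proof. by apply: definable_app1; apply: definable_stV. Qed.

Lemma definable_and3 m P Q S :
  definable m P -> definable m Q -> definable m S ->
  definable m (fun e => [/\ P e, Q e & S e]).
Proof.
move=> dP dQ dS; have := definable_and dP (definable_and dQ dS).
by apply: definable_iff => e; split=> [[? [? ?]]|[? ? ?]].
Qed.

Lemma definable_ex2 m (P Q : U -> (nat -> U) -> Prop) :
  definable m (fun e => P (e 0%N) (fun n => e n.+1)) ->
  definable m (fun e => Q (e 0%N) (fun n => e n.+1)) ->
  definable m (fun e => exists2 a, P a e & Q a e).
Proof.
move=> dP dQ; have := @definable_ex m (fun a e => P a e /\ Q a e)
  (definable_and dP dQ).
by apply: definable_iff => e; split=> [[a [? ?]]|[a ? ?]]; exists a.
Qed.

Lemma definable_exuniq m (P : U -> (nat -> U) -> Prop) :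
  definable m (fun e => P (e 0%N) (fun n => e n.+1)) ->
  definable m (fun e => exists! a, P a e).
Proof.
move=> dP; apply: definable_ex; apply: definable_and => //.
apply: definable_all; apply: definable_imp.
  exact: (definable_rename (fun n => if n is k.+1 then k.+2 else 0%N) dP).
exact: definable_eqV.
Qed.

Lemma term_description m f (P : U -> (nat -> U) -> Prop) (g : (nat -> U) -> U) :
  definable m (fun e => P (e 0%N) (fun n => e n.+1)) -> term m g ->
  (forall e a, a = f e <-> P a e \/ (~ exists b, P b e) /\ a = g e) ->
  term m f.
Proof.
move=> dP tg E; apply: (@definable_iff m (fun e =>
  P (e 0%N) (fun n => e n.+1) \/
  (~ exists b, P b (fun n => e n.+1)) /\ e 0%N = g (fun n => e n.+1))).
  by move=> e; rewrite -E.
apply: definable_or => //; apply: definable_and => //.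
apply/definable_not/definable_ex.
exact: (definable_rename (fun n => if n is k.+1 then k.+2 else 0%N) dP).
Qed.

End Constants.
End Definability.
Arguments definable_rename {U m} r {P}.

Section Schemes.
Variables (U : universe) (hU : IST U).
Let hZ := IST_ZFC hU.

Lemma definable_sat m (P : U -> Prop) :
  definable m (fun e => P (e 0%N)) ->
  exists p c, [/\ is_internal m -> internal p, forall n, admissible m (c n) &
    forall a, P a <-> sat (a ;; c) p].
Proof.
move=> [p [c [ip cc Pp]]].
exists (rename (fun n => if odd n then n./2.+1 else 0%N) p), c.
split=> [im|//|a]; first by rewrite internal_rename ip.
rewrite (Pp (fun=> a)) sat_rename.
suff -> : interleave (fun=> a) c =
  (fun n => (a ;; c) (if odd n then n./2.+1 else 0%N)) by [].
by apply/funext => n; rewrite /interleave; case: ifP.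
Qed.

Lemma transfer_all (P : U -> Prop) :
  definable Transfer (fun e => P (e 0%N)) ->
  (forall a, st a -> P a) -> forall a, P a.
Proof.
move=> /definable_sat [p [c [/(_ isT) ip cc Pp]]] stP a; rewrite Pp.
by apply: (transfer hU ip (fun n _ => cc n)) => b stb; rewrite -Pp; apply: stP.
Qed.

Lemma transfer_ex (P : U -> Prop) (a0 : U) (a0_st : st a0) :
  definable Transfer (fun e => P (e 0%N)) ->
  (exists a, P a) -> exists a, st a /\ P a.
Proof.
move=> dP [a Pa]; apply: contrapT => nex.
apply: (transfer_all (P := fun a => ~ P a)) Pa; last first.
  by move=> b stb Pb; apply: nex; exists b.
exact: (definable_not a0_st).
Qed.

Lemma separate (P : U -> Prop) (s : U) :
  definable Separation (fun e => P (e 0%N)) ->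
  exists b, forall z, z ∈ b <-> z ∈ s /\ P z.
Proof.
move=> /definable_sat [p [c [/(_ isT) ip _ Pp]]].
have [b bP] := separation hZ c s ip.
by exists b => z; rewrite bP Pp.
Qed.

Lemma standardize (P : U -> Prop) (s : U) : st s ->
  definable Standardization (fun e => P (e 0%N)) ->
  exists b, st b /\ forall z, st z -> (z ∈ b <-> z ∈ s /\ P z).
Proof.
move=> sts /definable_sat [p [c [_ _ Pp]]].
have [b [stb bP]] := standardization hU p c sts.
by exists b; split=> // z stz; rewrite bP // Pp.
Qed.

Lemma in_upair (a b z : U) : z ∈ upair a b <-> z = a \/ z = b.
Proof.
rewrite /upair /pick_or; case: pselect => [ex|nex].
  by case: (cid ex) => p /= ->.
by case: nex; have [p pP] := pairing hZ a b; exists p.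
Qed.

Lemma in_opair (a b z : U) : z ∈ opair a b <-> z = upair a a \/ z = upair a b.
Proof. exact: in_upair. Qed.

Lemma upair_inj (a b b' : U) : upair a b = upair a b' -> b = b'.
Proof.
move=> E; have /in_upair [ba|//] : b ∈ upair a b' by rewrite -E in_upair; right.
have /in_upair [b'a|//] : b' ∈ upair a b by rewrite E in_upair; right.
by rewrite ba.
Qed.

Lemma opair_inj (a b a' b' : U) : opair a b = opair a' b' -> a = a' /\ b = b'.
Proof.
move=> E.
have aa' : a = a'.
  have : upair a a ∈ opair a' b' by rewrite -E in_opair; left.
  rewrite in_opair => -[] E1.
    have : a ∈ upair a' a' by rewrite -E1 in_upair; left.
    by rewrite in_upair => -[].
  have : a' ∈ upair a a by rewrite E1 in_upair; left.
  by rewrite in_upair => -[].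
subst a'; split=> //.
have : upair a b ∈ opair a b' by rewrite -E in_opair; right.
rewrite in_opair => -[E1|/upair_inj //].
have : upair a b' ∈ opair a b by rewrite E in_opair; right.
rewrite in_opair => -[E2|/upair_inj //].
by apply: (@upair_inj a); rewrite E1 E2.
Qed.

End Schemes.

(** * Real numbers as definable terms *)

Section Terms.
Variables (U : universe) (hU : IST U) (R : real_system U).
Implicit Types (m : scheme) (x y : R) (f g h : (nat -> U) -> U).
Let st0 := Rset_st R.
Local Notation inR := (@inU U R).

Lemma inU_Rset (x : R) : inR x ∈ Rset R.
Proof. by have : elts (Rset R) (inR x) by rewrite RsetP; exists x. Qed.

Lemma Rset_inU (u : U) : u ∈ Rset R -> exists x : R, u = inR x.
Proof.
by move=> uR; have : elts (Rset R) u by []; rewrite RsetP => -[x _ <-]; exists x.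
Qed.

Lemma elts_in (g : U) (A : set U) (u : U) : elts g = A -> (u ∈ g <-> A u).
Proof. by move=> <-. Qed.

Lemma term_upair m f g :
  term m f -> term m g -> term m (fun e => upair (f e) (g e)).
Proof.
apply: (@term_app2 _ _ st0).
apply: (@definable_iff _ _ (fun e => forall z,
  z ∈ e 0%N <-> z = e 1%N \/ z = e 2%N)) => [e|].
  split=> [H|-> z]; last exact: in_upair.
  by apply: (Defs.extensionality (IST_ZFC hU)) => z; rewrite H in_upair.
apply: definable_all; apply: (definable_equiv st0).
  exact: (definable_memV st0).
by apply: (definable_or st0); apply: (definable_eqV st0).
Qed.

Lemma term_opair m f g :
  term m f -> term m g -> term m (fun e => opair (f e) (g e)).
Proof.
by move=> tf tg; apply: term_upair; apply: term_upair.
Qed.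

Lemma definable_opair_mem m f g h :
  term m f -> term m g -> term m h ->
  definable m (fun e => opair (f e) (g e) ∈ h e).
Proof. by move=> tf tg th; apply: (definable_mem st0) => //; apply: term_opair. Qed.

Lemma st_ex (P : U -> Prop) : definable Transfer (fun e => P (e 0%N)) ->
  (exists a, P a) -> exists a, st a /\ P a.
Proof. exact: (transfer_ex hU st0). Qed.

Lemma st_term (a : U) : term Transfer (fun=> a) -> st a.
Proof.
move=> ta; have [||b [stb <-]//] := @st_ex (fun b => b = a); last by exists a.
exact: (definable_rename (fun=> 0%N) ta).
Qed.

Lemma standard0 : standard (0 : R).
Proof.
have [g stg gP] := addK_st R.
pose P u := u ∈ Rset R /\ opair (opair u u) u ∈ g.
have [||u [stu]] := @st_ex P.
- apply: (definable_and st0); first apply: (definable_mem st0).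
  + exact: (term_var st0).
  + exact/term_cst.
  apply: definable_opair_mem; [apply: term_opair|..]; try exact: (term_var st0).
  exact/term_cst.
- exists (inR 0); split; first exact: inU_Rset.
  by apply/(elts_in _ gP); exists 0, 0; rewrite addr0.
move=> [/Rset_inU [x ux]]; subst u.
move=> /(elts_in _ gP) [y [z /(opair_inj hU) [/(opair_inj hU)]]].
move=> [/(inU_inj (r:=R)) xy /(inU_inj (r:=R)) xz /(inU_inj (r:=R)) xyz].
have x0 : 0 = x :> R by subst y z; apply: (@addrI _ x); rewrite addr0.
by rewrite /standard x0.
Qed.

Definition toR (u : U) : R := xget 0 [set x | inR x = u].

Lemma toRK (x : R) : toR (inR x) = x.
Proof. by apply: xget_unique => // y /(inU_inj (r:=R)). Qed.

Lemma inU_toR (u : U) : u ∈ Rset R -> inR (toR u) = u.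
Proof. by move=> /Rset_inU [x ->]; rewrite toRK. Qed.

Lemma toR_out (u : U) : ~ u ∈ Rset R -> toR u = 0.
Proof.
by move=> nu; apply: xgetPN => x /= xu; apply: nu; rewrite -xu; apply: inU_Rset.
Qed.

Lemma term_toR m f : term m f -> term m (fun e => inR (toR (f e))).
Proof.
apply: (@term_app1 _ _ st0 m (fun a => inR (toR a))).
apply: (@term_description _ _ st0 m _ (fun a e => a ∈ Rset R /\ a = e 0%N)
  (fun=> inR 0)).
- apply: (definable_and st0); last exact: (definable_eqV st0).
  by apply: (definable_mem st0); [exact: (term_var st0)|exact/term_cst/admissible_st].
- exact/term_cst/admissible_st/standard0.
move=> e a; have [eR|neR] := pselect (e 0%N ∈ Rset R).
  rewrite inU_toR //; split=> [->|[[]|[nex]]//]; first by left.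
  by case: nex; exists (e 0%N).
rewrite toR_out //; split=> [->|[[aR ae]|[]]//]; last by rewrite -ae in neR.
by right; split=> // -[b [bR be]]; rewrite -be in neR.
Qed.

Section Operations.
Implicit Types F G : (nat -> U) -> R.
Notation rterm m F := (term m (fun e => inR (F e))).

Lemma term_op m (op : R -> R -> R) F G :
  (exists2 g : U, st g & elts g = [set u | exists x y,
     u = opair (opair (inR x) (inR y)) (inR (op x y))]) ->
  rterm m F -> rterm m G -> rterm m (fun e => op (F e) (G e)).
Proof.
move=> [g stg gP] tF tG.
have -> : (fun e => inR (op (F e) (G e))) =
  (fun e => inR (op (toR (inR (F e))) (toR (inR (G e))))).
  by apply/funext => e; rewrite !toRK.
apply: (@term_app2 _ _ st0 m (fun a b => inR (op (toR a) (toR b)))) => //.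
apply: (@definable_iff _ _ (fun e =>
  opair (opair (inR (toR (e 1%N))) (inR (toR (e 2%N)))) (e 0%N) ∈ g)) => [e|].
  rewrite (elts_in _ gP); split=> [[x [y]]|->]; last by do 2!eexists.
  move=> /(opair_inj hU) [/(opair_inj hU)].
  by move=> [/(inU_inj (r:=R)) -> /(inU_inj (r:=R)) ->].
apply: definable_opair_mem; [apply: term_opair; apply: term_toR|..];
  try exact: (term_var st0).
exact/term_cst/admissible_st.
Qed.

Lemma term_add m F G : rterm m F -> rterm m G -> rterm m (fun e => F e + G e).
Proof. by apply: term_op; apply: addK_st. Qed.

Lemma term_mul m F G : rterm m F -> rterm m G -> rterm m (fun e => F e * G e).
Proof. by apply: term_op; apply: mulK_st. Qed.

Lemma definable_eqR m F G :
  rterm m F -> rterm m G -> definable m (fun e => F e = G e).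
Proof.
move=> tF tG; have := definable_eq st0 tF tG; apply: definable_iff => e.
by split=> [/(inU_inj (r:=R))|->].
Qed.

Lemma definable_le m F G :
  rterm m F -> rterm m G -> definable m (fun e => F e <= G e).
Proof.
have [g stg gP] := leK_st R; move=> tF tG.
apply: (@definable_iff _ _ (fun e => opair (inR (F e)) (inR (G e)) ∈ g)) => [e|].
  rewrite (elts_in _ gP); split=> [[x [y []]]|le]; last by exists (F e), (G e).
  by move=> le /(opair_inj hU) [/(inU_inj (r:=R)) -> /(inU_inj (r:=R)) ->].
by apply: definable_opair_mem => //; exact/term_cst/admissible_st.
Qed.

Lemma definable_lt m F G :
  rterm m F -> rterm m G -> definable m (fun e => F e < G e).
Proof.
move=> tF tG; have := definable_not st0 (definable_le tG tF).
by apply: definable_iff => e; rewrite ltNge; split=> /negP.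
Qed.

Lemma definable_neqR m F G :
  rterm m F -> rterm m G -> definable m (fun e => F e != G e).
Proof.
move=> tF tG; have := definable_not st0 (definable_eqR tF tG).
by apply: definable_iff => e; split=> /eqP.
Qed.

Lemma definable_andb m (b b' : (nat -> U) -> bool) :
  definable m (fun e => b e) -> definable m (fun e => b' e) ->
  definable m (fun e => b e && b' e).
Proof.
move=> db db'; have := definable_and st0 db db'.
by apply: definable_iff => e; split=> /andP.
Qed.

Lemma term_opp m F : rterm m F -> rterm m (fun e => - F e).
Proof.
move=> tF; apply: (@definable_iff _ _ (fun e => e 0%N ∈ Rset R /\
  F (fun n => e n.+1) + toR (e 0%N) = 0)) => [e|].
  split=> [[/Rset_inU [x ->]]|->]; last first.
    by split; [exact: inU_Rset|rewrite toRK subrr].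
  by rewrite toRK => /eqP; rewrite addrC addr_eq0 => /eqP ->.
apply: (definable_and st0).
  by apply: (definable_mem st0); [exact: (term_var st0)|exact/term_cst/admissible_st].
apply: definable_eqR; last exact/term_cst/admissible_st/standard0.
apply: term_add; last exact/term_toR/(term_var st0).
exact: (term_rename S tF).
Qed.

Lemma term_abs m F : rterm m F -> rterm m (fun e => `|F e|).
Proof.
move=> tF; have tF' := term_rename S tF.
apply: (@definable_iff _ _ (fun e =>
  let x := F (fun n => e n.+1) in
  0 <= x /\ e 0%N = inR x \/ ~ 0 <= x /\ e 0%N = inR (- x))) => [e /=|].
  have [x0|/negP x0] := boolP (0 <= F (fun n => e n.+1)).
    by rewrite ger0_norm //; split=> [[[]|[]]|]; by [|left|move=> ?].
  rewrite ltr0_norm ?ltNge; last exact/negP.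
  by split=> [[[]|[]]|]; by [|right|move=> ?].
have z : rterm m (fun=> 0) by exact/term_cst/admissible_st/standard0.
apply: (definable_or st0); apply: (definable_and st0).
- exact: definable_le.
- by apply: (definable_eq st0) => //; exact: (term_var st0).
- exact/(definable_not st0)/definable_le.
- by apply: (definable_eq st0); [exact: (term_var st0)|exact: term_opp].
Qed.

Lemma definable_allR m (P : R -> (nat -> U) -> Prop) :
  definable m (fun e => P (toR (e 0%N)) (fun n => e n.+1)) ->
  definable m (fun e => forall x : R, P x e).
Proof.
move=> dP; have := @definable_all _ m (fun a e => P (toR a) e) dP.
by apply: definable_iff => e; split=> H x //; rewrite -[x]toRK.
Qed.

Lemma definable_exR m (P : R -> (nat -> U) -> Prop) :
  definable m (fun e => P (toR (e 0%N)) (fun n => e n.+1)) ->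
  definable m (fun e => exists x : R, P x e).
Proof.
move=> dP; have := @definable_ex _ _ st0 m (fun a e => P (toR a) e) dP.
apply: definable_iff => e; split=> -[x Px]; first by exists (toR x).
by exists (inR x); rewrite toRK.
Qed.

Lemma definable_ex2R m (P Q : R -> (nat -> U) -> Prop) :
  definable m (fun e => P (toR (e 0%N)) (fun n => e n.+1)) ->
  definable m (fun e => Q (toR (e 0%N)) (fun n => e n.+1)) ->
  definable m (fun e => exists2 x : R, P x e & Q x e).
Proof.
move=> dP dQ; have := @definable_exR m (fun x e => P x e /\ Q x e)
  (definable_and st0 dP dQ).
by apply: definable_iff => e; split=> [[x []]|[x]]; exists x.
Qed.

End Operations.

Section Application.

(* The value of a function, defined by a description that Separation and Transfer
  can see; [app] goes through [pick_or], which is a choice of the metatheory. *)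
Definition ap (f a : U) : U :=
  pick_or f [set b | forall b', opair a b' ∈ f <-> b' = b].

Definition component (v i : U) : R := toR (ap v i).

Lemma apE (f a b : U) : (forall b', opair a b' ∈ f <-> b' = b) -> ap f a = b.
Proof.
move=> H; rewrite /ap /pick_or; case: pselect => [ex|[]]; last by exists b.
by case: (cid ex) => c /= cP; apply/H/cP.
Qed.

Lemma term_ap m f g : term m f -> term m g -> term m (fun e => ap (f e) (g e)).
Proof.
apply: (@term_app2 _ _ st0).
apply: (@term_description _ _ st0 m _
  (fun b e => forall b', opair (e 1%N) b' ∈ e 0%N <-> b' = b) (fun e => e 0%N)).
- apply: definable_all; apply: (definable_equiv st0);
    last exact: (definable_eqV st0).
  by apply: definable_opair_mem; exact: (term_var st0).
- exact: (term_var st0).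
move=> e a; split=> [->|[/apE <- //|[nex ->]]].
  have [[b bP]|nex] := pselect (exists b, forall b',
      opair (e 1%N) b' ∈ e 0%N <-> b' = b).
    by left; rewrite (apE bP).
  by right; split=> //; rewrite /ap /pick_or; case: pselect.
by rewrite /ap /pick_or; case: pselect.
Qed.

Lemma term_component m f g :
  term m f -> term m g -> term m (fun e => inR (component (f e) (g e))).
Proof. by move=> tf tg; apply/term_toR/term_ap. Qed.

End Application.

Lemma definable_standard (F : (nat -> U) -> R) :
  term Standardization (fun e => inR (F e)) ->
  definable Standardization (fun e => standard (F e)).
Proof. exact: (definable_st st0). Qed.

End Terms.

(* Compound terms are decomposed before [term_cst] is tried, so that for Transfer only
  the constants in them have to be known to be standard. *)
Ltac definability hU R :=
  let st0 := constr:(Rset_st R) in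
  repeat (cbv beta; first
  [ simple apply (definable_and3 st0)
  | simple apply (definable_and st0)
  | simple apply (definable_or st0)
  | simple apply (definable_equiv st0)
  | simple apply (definable_not st0)
  | simple apply (@definable_ex2R _ R)
  | simple apply (definable_ex2 st0)
  | simple apply (@definable_exR _ R)
  | simple apply (definable_exuniq st0)
  | simple apply (definable_ex st0)
  | simple apply (@definable_le _ hU R)
  | simple apply (@definable_lt _ hU R)
  | simple apply (@definable_andb _ R)
  | simple apply (@definable_neqR _ R)
  | simple apply (@definable_eqR _ R)
  | simple apply definable_imp
  | simple apply (@definable_allR _ R)
  | simple apply definable_all
  | simple apply (definable_mem st0)
  | simple apply (definable_eq st0)
  | simple apply (@definable_standard _ R)
  | simple apply (definable_st st0)
  | simple apply (term_var st0)
  | simple apply (@term_add _ hU R)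
  | simple apply (@term_mul _ hU R)
  | simple apply (@term_opp _ hU R)
  | simple apply (@term_abs _ hU R)
  | simple apply (@term_component _ hU R)
  | simple apply (@term_toR _ hU R)
  | simple apply (@term_ap _ hU R)
  | simple apply (@term_opair _ hU R)
  | simple apply term_cst
  | exact Logic.I | eassumption ]).

Section Reals.
Variables (U : universe) (hU : IST U) (R : real_system U).
Implicit Types (x y : R).
Local Notation inR := (@inU U R).

Lemma st_exR (P : R -> Prop) : definable Transfer (fun e => P (toR R (e 0%N))) ->
  (exists x, P x) -> exists x, standard x /\ P x.
Proof.
move=> dP [x Px].
have [||u [stu [uR Pu]]] := @st_ex _ hU R (fun u => u ∈ Rset R /\ P (toR R u)).
- definability hU R => //; exact: Rset_st.
- by exists (inR x); rewrite toRK; split=> //; exact: inU_Rset.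
by exists (toR R u); rewrite /standard inU_toR.
Qed.

Lemma transferR (P : R -> Prop) : definable Transfer (fun e => P (toR R (e 0%N))) ->
  (forall x, standard x -> P x) -> forall x, P x.
Proof.
move=> dP stP x; apply: contrapT => nPx.
have [||y [sty]] := @st_exR (fun x => ~ P x); last by move/(_ (stP y sty)).
- exact: (definable_not (Rset_st R)).
- by exists x.
Qed.

Lemma standardD x y : standard x -> standard y -> standard (x + y).
Proof. by move=> sx sy; apply: (@st_term _ hU R); definability hU R. Qed.

Lemma standardN x : standard x -> standard (- x).
Proof. by move=> sx; apply: (@st_term _ hU R); definability hU R. Qed.

Lemma standardM x y : standard x -> standard y -> standard (x * y).
Proof. by move=> sx sy; apply: (@st_term _ hU R); definability hU R. Qed.

Lemma standard1 : standard (1 : R).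
Proof.
have s0 := standard0 hU R.
have [||x [sx [x0 xx]]] := @st_exR (fun x => x != 0 /\ x * x = x).
- by definability hU R.
- by exists 1; rewrite oner_neq0 mulr1.
by rewrite (_ : 1 = x) //; apply: (mulfI x0); rewrite mulr1.
Qed.

Lemma standardV x : standard x -> standard x^-1.
Proof.
have s0 := standard0 hU R; have s1 := standard1.
move=> sx; have [->|x0] := eqVneq x 0; first by rewrite invr0.
have [||y [sy xy]] := @st_exR (fun y => x * y = 1).
- by definability hU R.
- by exists x^-1; rewrite mulfV.
by rewrite (_ : x^-1 = y) //; apply: (mulfI x0); rewrite mulfV.
Qed.

Lemma standard_nat n : standard (n%:R : R).
Proof.
elim: n => [|n IH]; first exact: standard0.
by rewrite -natr1; apply: standardD => //; exact: standard1.
Qed.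

End Reals.

(** * Functions, vectors and norms *)

Section Vectors.
Variables (U : universe) (hU : IST U) (R : real_system U).
Implicit Types (x y : R) (v w f g : U).
Local Notation inR := (@inU U R).

Lemma is_function_ap (A B : set U) f a : is_function A B f -> A a ->
  B (ap f a) /\ forall b, opair a b ∈ f <-> b = ap f a.
Proof.
move=> [fP /[swap] Aa /(_ a Aa) [b [fb bu]]].
have E b' : opair a b' ∈ f <-> b' = b by split=> [/bu|->].
rewrite (apE E); split=> //.
by have [a' [b' [_ Bb' /(opair_inj hU) [_ ->]]]] := fP _ fb.
Qed.

Lemma app_ap (A B : set U) f a : is_function A B f -> A a -> app f a = ap f a.
Proof.
move=> ff Aa; have [_ E] := is_function_ap ff Aa; apply/E.
rewrite /app /pick_or; case: pselect => [ex|[]]; first by case: (cid ex).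
by exists (ap f a); apply/E.
Qed.

Lemma is_function_ext (A B : set U) f g : is_function A B f -> is_function A B g ->
  (forall a, A a -> ap f a = ap g a) -> f = g.
Proof.
move=> ff fg E; apply: (Defs.extensionality (IST_ZFC hU)) => p; split=> pf.
  have [a [b [Aa _ pE]]] := ff.1 p pf; subst p.
  by apply/(is_function_ap fg Aa).2; rewrite -E //; apply/(is_function_ap ff Aa).2.
have [a [b [Aa _ pE]]] := fg.1 p pf; subst p.
by apply/(is_function_ap ff Aa).2; rewrite E //; apply/(is_function_ap fg Aa).2.
Qed.

Variables (d : U) (hd : is_nat d) (hd_st : st d) (hd_pos : exists i, i ∈ d).
Local Notation vec := (vectors R d).

Lemma vecP v : vec v <->
  (forall p, p ∈ v -> exists i, exists x, i ∈ d /\ p = opair i (inR x)) /\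
  (forall i, i ∈ d -> exists! b, opair i b ∈ v).
Proof.
split=> -[vP vf]; split=> // p pv.
  by have [i [_ [id' [x _ <-] ->]]] := vP p pv; exists i, x.
have [i [x [id' ->]]] := vP p pv.
by exists i, (inR x); split=> //; exists x.
Qed.

Lemma definable_vec m (f : (nat -> U) -> U) :
  (m = Transfer -> st d) -> term m f -> definable m (fun e => vec (f e)).
Proof.
move=> std tf; apply: (definable_app1 (Rset_st R)) tf.
have ad : admissible m d by case: m std => // /(_ erefl).
apply: (definable_iff (fun e => iff_sym (vecP (e 0%N)))).
by definability hU R.
Qed.

Lemma inR_component v i : vec v -> i ∈ d -> inR (component R v i) = ap v i.
Proof.
move=> vv id'; have [[x _ xE] _] := is_function_ap vv id'.
by rewrite /component -xE toRK.
Qed.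

Lemma opair_component v i x : vec v -> i ∈ d ->
  opair i (inR x) ∈ v <-> x = component R v i.
Proof.
move=> vv id'; have [_ E] := is_function_ap vv id'.
by rewrite E -inR_component //; split=> [/(inU_inj (r:=R))|->].
Qed.

Lemma coord_component v i : vec v -> i ∈ d -> Defs.coord R v i = component R v i.
Proof.
move=> vv id'; rewrite /Defs.coord (app_ap vv id') -inR_component //.
by apply: xget_unique => // y /(inU_inj (r:=R)).
Qed.

Lemma vec_ext v w : vec v -> vec w ->
  (forall i, i ∈ d -> component R v i = component R w i) -> v = w.
Proof.
move=> vv vw E; apply: (is_function_ext vv vw) => i id'.
by rewrite -!inR_component ?E.
Qed.

Lemma nat_ind_internal (P : U -> Prop) :
  definable Separation (fun e => P (e 0%N)) ->
  (forall z, (forall w, ~ w ∈ z) -> P z) ->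
  (forall n s, P n -> (forall z, z ∈ s <-> z ∈ n \/ z = n) -> P s) ->
  forall n, is_nat n -> P n.
Proof.
move=> dP P0 PS n nn; have [a [a0 aS]] := infinity (IST_ZFC hU).
have [b bP] := separate hU a dP.
suff /bP [] : n ∈ b by [].
apply: nn; split=> [z z0|k /bP [ka Pk] s sP]; apply/bP; split.
- exact: a0.
- exact: P0.
- exact: aS ka s sP.
- exact: PS sP.
Qed.

Lemma nat_ind_external (P : U -> Prop) :
  definable Standardization (fun e => P (e 0%N)) ->
  (forall z, (forall w, ~ w ∈ z) -> P z) ->
  (forall n s, st n -> P n -> (forall z, z ∈ s <-> z ∈ n \/ z = n) -> P s) ->
  forall n, is_nat n -> st n -> P n.
Proof.
move=> dP P0 PS n nn stn.
have [||a [sta aI]] := @st_ex _ hU R (@inductive_set U).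
- by rewrite /inductive_set; definability hU R.
- exact: (infinity (IST_ZFC hU)).
have [b [stb bP]] := standardize hU sta dP.
suff : n ∈ b by move/(bP n stn) => -[].
apply: nn; split.
  apply: (transfer_all hU); first by definability hU R.
  by move=> z stz z0; apply/bP => //; split; [apply: aI.1|apply: P0].
apply: (transfer_all hU); first by definability hU R.
move=> k stk; move/(bP k stk) => [ka Pk].
apply: (transfer_all hU); first by definability hU R.
move=> s sts sP; apply/bP => //; split; first exact: aI.2 ka s sP.
exact: PS stk Pk sP.
Qed.

Lemma st_index i : i ∈ d -> st i.
Proof.
move: i; apply: (nat_ind_external (P := fun n => forall i, i ∈ n -> st i)) => //.
- by definability hU R.
- by move=> z z0 i /z0.
- by move=> n s stn IH sP i /sP [/IH|->].
Qed.

Lemma family_max (c : U -> R) : term Separation (fun e => inR (c (e 0%N))) ->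
  exists2 i, i ∈ d & forall j, j ∈ d -> `|c j| <= `|c i|.
Proof.
move=> tc; have tcf (f : (nat -> U) -> U) : term Separation f ->
    term Separation (fun e => inR (c (f e))).
  exact: (@term_app1 _ _ (Rset_st R) _ (fun a => inR (c a))).
apply: (nat_ind_internal (P := fun n => (exists i, i ∈ n) ->
  exists2 i, i ∈ n & forall j, j ∈ n -> `|c j| <= `|c i|)) hd_pos => //.
- definability hU R; apply: tcf; definability hU R.
- by move=> z z0 [i /z0].
move=> n s IH sP _.
have [/IH [i ni imax]|nex] := pselect (exists i, i ∈ n); last first.
  exists n; first by apply/sP; right.
  by move=> j /sP [jn|->//]; case: nex; exists j.
have [cin|cni] := leP `|c i| `|c n|.
  exists n; first by apply/sP; right.
  by move=> j /sP [jn|->//]; apply: le_trans (imax j jn) cin.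
exists i; first by apply/sP; left.
by move=> j /sP [/imax //|->]; exact: ltW.
Qed.

Lemma normP (c c' : U -> R) : term Separation (fun e => inR (c' (e 0%N))) ->
  (forall i, i ∈ d -> c i = c' i) ->
  (exists2 i, i ∈ d & `|c' i| = norm d c) /\
  (forall i, i ∈ d -> `|c' i| <= norm d c).
Proof.
move=> /family_max [i id' imax] E.
suff -> : norm d c = `|c' i| by split=> //; exists i.
apply: xget_unique => [|r /= [[j jd <-] jmax]].
  by split; [exists i; rewrite ?E|move=> j jd; rewrite E ?imax].
by apply/le_anti; rewrite -{2}E // jmax // E // imax.
Qed.

Lemma norm_le (c c' : U -> R) r : term Separation (fun e => inR (c' (e 0%N))) ->
  (forall i, i ∈ d -> c i = c' i) ->
  norm d c <= r <-> forall i, i ∈ d -> `|c' i| <= r.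
Proof.
move=> tc E; have [[j jd jE] jmax] := normP tc E.
by split=> [nr i id'|H]; [exact: le_trans (jmax i id') nr|rewrite -jE H].
Qed.

Lemma norm_lt (c c' : U -> R) r : term Separation (fun e => inR (c' (e 0%N))) ->
  (forall i, i ∈ d -> c i = c' i) ->
  norm d c < r <-> forall i, i ∈ d -> `|c' i| < r.
Proof.
move=> tc E; have [[j jd jE] jmax] := normP tc E.
by split=> [nr i id'|H]; [exact: le_lt_trans (jmax i id') nr|rewrite -jE H].
Qed.

Lemma norm_ge0 (c c' : U -> R) : term Separation (fun e => inR (c' (e 0%N))) ->
  (forall i, i ∈ d -> c i = c' i) -> 0 <= norm d c.
Proof. by move=> tc E; have [[j jd <-] _] := normP tc E. Qed.

End Vectors.

(** * Standard parts *)

Section StandardPart.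
Variables (U : universe) (hU : IST U) (R : real_system U).
Implicit Types (x y : R) (v w : U).
Local Notation inR := (@inU U R).
Let Sn := standard_nat hU R.
Let SD := @standardD _ hU R.
Let SM := @standardM _ hU R.
Let SN := @standardN _ hU R.
Let SV := @standardV _ hU R.

Lemma infinitesimal_le x y : `|y| <= `|x| -> infinitesimal x -> infinitesimal y.
Proof. by move=> yx ix e se e0; apply: le_lt_trans yx (ix e se e0). Qed.

Lemma infinitesimalN x : infinitesimal x -> infinitesimal (- x).
Proof. by apply: infinitesimal_le; rewrite normrN. Qed.

Lemma infinitesimalD x y : infinitesimal x -> infinitesimal y -> infinitesimal (x + y).
Proof.
move=> ix iy e se e0; have s2 : standard (e / 2%:R) by apply/SM/SV.
have p2 : 0 < e / 2%:R by lra.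
by have := ler_normD x y; have := ix _ s2 p2; have := iy _ s2 p2; lra.
Qed.

Lemma infinitesimal_sub x y z :
  infinitesimal (x - y) -> infinitesimal (y - z) -> infinitesimal (x - z).
Proof. by move=> /infinitesimalD H /H; rewrite addrA subrK. Qed.

Lemma infinitesimal_subC x y : infinitesimal (x - y) -> infinitesimal (y - x).
Proof. by move=> /infinitesimalN; rewrite opprB. Qed.

Lemma infinitesimalM x (b : R) : standard b -> 0 <= b -> infinitesimal x ->
  infinitesimal (x * b).
Proof.
move=> sb b0 ix e se e0; have b1 : 0 < b + 1 by lra.
have := ix (e / (b + 1)) (SM se (SV (SD sb (Sn 1)))) (divr_gt0 e0 b1).
by rewrite normrM (ger0_norm b0) ltr_pdivlMr //; have := normr_ge0 x; nra.
Qed.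

Lemma standard_infinitesimal x : standard x -> infinitesimal x -> x = 0.
Proof.
move=> sx ix; have [//|x0] := eqVneq x 0.
have [p|p] := ltP 0 x; first by have := ix x sx p; rewrite gtr0_norm // ltxx.
have n0 : 0 < - x by move: x0 p; case: ltgtP => //; lra.
by have := ix (- x) (SN sx) n0; rewrite -normrN gtr0_norm // ltxx.
Qed.

Lemma limited_standard x : standard x -> limited x.
Proof.
move=> sx; have [x0|x0] := leP 0 x.
  exists (x + 1); split; [exact: SD (Sn 1)|lra|by rewrite ger0_norm //; lra].
exists (- x + 1); split; [by apply: SD (Sn 1); exact: SN|lra|].
by rewrite ltr0_norm //; lra.
Qed.

Lemma limited_le x y : `|y| <= `|x| -> limited x -> limited y.
Proof. by move=> yx [e [se e0 xe]]; exists e; split=> //; apply: le_trans xe. Qed.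

Lemma ex_supremum (P : R -> Prop) :
  definable Separation (fun e => P (toR R (e 0%N))) ->
  (exists x, P x) -> (exists b, forall x, P x -> x <= b) ->
  exists s, (forall x, P x -> x <= s) /\
    (forall b, (forall x, P x -> x <= b) -> s <= b).
Proof.
move=> dP [x Px] [b bP].
have [a aP] := @separate _ hU (fun u => P (toR R u)) (Rset R) dP.
have aE y : inR y ∈ a <-> P y.
  by rewrite aP toRK; split=> [[]|Py] //; split=> //; exact: inU_Rset.
have [|s [sub slb]] := @Dedekind U R a.
  by split; [exists x; apply/aE|exists b => y /aE; apply: bP].
exists s; split=> [y Py|c cP]; first exact/sub/aE.
by apply: slb => y /aE; apply: cP.
Qed.

Lemma standard_part x : limited x -> exists x0, standard x0 /\ infinitesimal (x - x0).
Proof.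
move=> [e [se e0 xe]].
have [|a [sta aP]] := @standardize _ hU (fun u => toR R u <= x) _ (Rset_st R).
  by definability hU R.
have {}aP y : standard y -> (inR y ∈ a <-> y <= x).
  move=> sy; rewrite aP // toRK; split=> [[]|yx] //; split=> //.
  exact: inU_Rset.
have bound b : standard b -> x <= b -> forall y, inR y ∈ a -> y <= b.
  move=> sb xb; apply: (transferR hU) => [|y sy]; first by definability hU R.
  by rewrite aP // => yx; apply: le_trans xb.
have [||s [ss [sub slb]]] := @st_exR _ hU R (fun s =>
  (forall y, inR y ∈ a -> y <= s) /\
  (forall b, (forall y, inR y ∈ a -> y <= b) -> s <= b)).
- by definability hU R.
- apply: ex_supremum; first by definability hU R.
  + exists (- e); apply/aP; first exact: SN.
    by move: xe; rewrite ler_norml => /andP[].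
  + by exists e; apply: bound => //; apply: le_trans (ler_norm x) xe.
exists s; split=> // r sr r0; rewrite ltr_norml; apply/andP; split.
- rewrite ltNge; apply/negP => H.
  have /slb : forall y, inR y ∈ a -> y <= s - r.
    by apply: bound; [exact/SD/SN|lra].
  by lra.
- rewrite ltNge; apply/negP => H.
  have /sub : inR (s + r) ∈ a by apply/aP; [exact: SD|lra].
  by lra.
Qed.

Lemma underspill (P : R -> Prop) (mu : R) :
  definable Separation (fun e => P (toR R (e 0%N))) ->
  (forall x y, 0 < y -> y <= x -> P x -> P y) ->
  0 < mu -> infinitesimal mu ->
  (forall x, 0 < x -> infinitesimal x -> P x) ->
  exists x, [/\ standard x, 0 < x & P x].
Proof.
move=> dP down mu0 imu infP; apply: contrapT => nex.
have small x : 0 < x -> P x -> forall e, standard e -> 0 < e -> x <= e.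
  move=> x0 Px e se e0; rewrite leNgt; apply/negP => ex; apply: nex; exists e.
  by split=> //; apply: down Px => //; exact: ltW.
have [|||s [sub slb]] := @ex_supremum (fun x => 0 < x /\ P x).
- have z := standard0 hU R; definability hU R; exact: dP.
- by exists mu; split; [|exact: infP].
- by exists 1 => x [x0 Px]; apply: small => //; exact: Sn 1.
have s0 : 0 < s by apply: lt_le_trans (sub mu _) => //; split=> //; exact: infP.
have si : infinitesimal s.
  move=> e se e0; rewrite gtr0_norm //.
  suff : s <= e / 2%:R by lra.
  by apply: slb => x [x0 Px]; apply: small => //; [exact/SM/SV|lra].
have : s + s <= s by apply: sub; split; [lra|apply: infP; [lra|exact: infinitesimalD]].
lra.
Qed.

Lemma ex_product (a b : U) :
  exists s, forall v, v ∈ a -> forall w, w ∈ b -> opair v w ∈ s.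
Proof.
have [p pP] := pairing (IST_ZFC hU) a b.
have [u uP] := union (IST_ZFC hU) p.
have [q qP] := power (IST_ZFC hU) u.
have [s sP] := power (IST_ZFC hU) q.
exists s => v va w wb; apply/sP => z /(in_opair hU) H; apply/qP => t tz.
have : t = v \/ t = w.
  by case: H tz => -> /(in_upair hU) [->|->]; by [left|right].
move=> [->|->]; apply/uP.
  by exists a => //; apply/pP; left.
by exists b => //; apply/pP; right.
Qed.

Lemma ex_standard_product (a b : U) : st a -> st b ->
  exists2 s, st s & forall v, v ∈ a -> forall w, w ∈ b -> opair v w ∈ s.
Proof.
move=> sta stb; have [||s [sts sP]] := @st_ex _ hU R (fun s =>
  forall v, v ∈ a -> forall w, w ∈ b -> opair v w ∈ s).
- by definability hU R.
- exact: ex_product.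
- by exists s.
Qed.

Lemma st_opair (a b : U) : st a -> st b -> st (opair a b).
Proof. by move=> sta stb; apply: (@st_term _ hU R); definability hU R. Qed.

Variables (d : U) (hd : is_nat d) (hd_st : st d).
Local Notation vec := (vectors R d).

Lemma standard_component v i : st v -> i ∈ d -> standard (component R v i).
Proof.
move=> stv id'; have sti := st_index hU R hd hd_st id'.
by apply: (@st_term _ hU R); definability hU R.
Qed.

Lemma standard_part_vec v : vec v -> (forall i, i ∈ d -> limited (component R v i)) ->
  exists w, [/\ st w, vec w &
    forall i, i ∈ d -> infinitesimal (component R v i - component R w i)].
Proof.
move=> vv lv; have z := standard0 hU R.
have [s sts sP] := ex_standard_product hd_st (Rset_st R).
have [|w [stw wP]] := @standardize _ hU (fun p => exists i, exists x,
  [/\ i ∈ d, p = opair i (inR x) &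
    forall e, standard e -> 0 < e -> `|component R v i - x| < e]) s sts.
  by definability hU R.
have wP' := wP; have {}wP i x : i ∈ d -> standard x ->
    (opair i (inR x) ∈ w <-> infinitesimal (component R v i - x)).
  move=> id' sx; rewrite wP; last exact: st_opair (st_index hU R hd hd_st id') sx.
  split=> [[_ [i' [x' [_ /(opair_inj hU) [-> /(inU_inj (r:=R)) ->]]]]] //|ix].
  by split; [apply: sP (inU_Rset x)|exists i, x].
have std_i := @st_index _ hU R _ hd hd_st.
have vw : vec w.
  apply/vecP; split.
    apply: (transfer_all hU); first by definability hU R.
    by move=> p stp; rewrite wP' // => -[_ [i [x [id' -> _]]]]; exists i, x.
  apply: (transfer_all hU); first by definability hU R.
  move=> i sti id'; have [x [sx ix]] := standard_part (lv i id').
  exists (inR x); split; first exact/wP.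
  apply: (transfer_all hU); first by definability hU R.
  move=> b stb; rewrite wP'; last exact: st_opair.
  move=> [_ [i' [y [_ /(opair_inj hU) [<- bE] iy]]]]; rewrite bE in stb *.
  congr inU; apply/eqP; rewrite -subr_eq0; apply/eqP.
  apply: standard_infinitesimal; first exact/SD/SN.
  by apply: infinitesimal_sub iy; apply: infinitesimal_subC.
exists w; split=> // i id'.
apply/(wP _ _ id' (standard_component stw id')).
by apply/(opair_component hU (component R w i) vw id').
Qed.

End StandardPart.

Section Components.
Variables (U : universe) (hU : IST U) (R : real_system U).
Variables (d : U) (hd : is_nat d) (hd_pos : exists i, i ∈ d).
Implicit Types (t s : R) (v w f : U).
Local Notation inR := (@inU U R).
Local Notation vec := (vectors R d).

Lemma dist_lt v w (e : R) : vec v -> vec w ->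
  dist R d v w < e <->
  forall i, i ∈ d -> `|component R v i - component R w i| < e.
Proof.
move=> vv vw; apply: (norm_lt hU hd hd_pos); first by definability hU R.
by move=> i id'; rewrite (coord_component hU vv id') (coord_component hU vw id').
Qed.

Lemma vnear_component v w : vec v -> vec w ->
  vnear R d v w <->
  forall i, i ∈ d -> infinitesimal (component R v i - component R w i).
Proof.
move=> vv vw.
have n0 : 0 <= dist R d v w.
  apply: (norm_ge0 hU hd hd_pos (c' := fun i => component R v i - component R w i)).
    by definability hU R.
  by move=> i id'; rewrite (coord_component hU vv id') (coord_component hU vw id').
split=> [H i id' e se e0|H e se e0]; last first.
  by rewrite ger0_norm //; apply/dist_lt => // i id'; apply: H.
by move: i id'; apply/dist_lt => //; move: (H e se e0); rewrite ger0_norm.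
Qed.

Lemma vlimited_component v : vec v ->
  vlimited R d v <->
  exists e, [/\ standard e, 0 < e & forall i, i ∈ d -> `|component R v i| <= e].
Proof.
move=> vv; have tv : term Separation (fun e => inR (component R v (e 0%N))).
  by definability hU R.
have E i (id' : i ∈ d) := coord_component hU vv id'.
have n0 := norm_ge0 hU hd hd_pos tv E.
split=> -[e [se e0 H]]; exists e; split=> //; last first.
  by rewrite ger0_norm //; apply/(norm_le hU hd hd_pos e tv E).
by apply/(norm_le hU hd hd_pos e tv E); rewrite ger0_norm in H.
Qed.

Lemma slope_dist_lt f t s v (e : R) :
  vec (ap f (inR t)) -> vec (ap f (inR s)) -> vec v ->
  app f (inR t) = ap f (inR t) -> app f (inR s) = ap f (inR s) -> s != t ->
  slope_dist d f t s v < e <->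
  forall i, i ∈ d -> `|component R (ap f (inR s)) i - component R (ap f (inR t)) i
    - (s - t) * component R v i| < e * `|s - t|.
Proof.
move=> vt vs vv Et Es st; rewrite /slope_dist Et Es.
pose c i := (component R (ap f (inR s)) i - component R (ap f (inR t)) i) / (s - t)
  - component R v i.
rewrite (norm_lt (c' := c) hU hd hd_pos); first last.
- by move=> i id'; rewrite /c !(coord_component hU _ id').
- by rewrite /c; definability hU R.
have st0 : s - t != 0 by rewrite subr_eq0.
have p0 : 0 < `|s - t| by rewrite normr_gt0.
suff E i : `|c i| < e <-> `|component R (ap f (inR s)) i -
    component R (ap f (inR t)) i - (s - t) * component R v i| < e * `|s - t|.
  by split=> H i /H /E.
rewrite -(ltr_pM2r p0) -normrM /c mulrBl divfK // [_ * (s - t)]mulrC.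
by [].
Qed.

End Components.

(** * The shadow of a stroboscopic function *)

Section Strobing.
Variables (U : universe) (hU : IST U) (R : real_system U).
Variables (d : U) (hd : is_nat d) (hd_st : st d) (hd_pos : exists i, i ∈ d).
Local Notation inR := (@inU U R).
Local Notation vec := (vectors R d).
Implicit Types (t s : R) (v : U).

Let Sn := standard_nat hU R.
Let SD := @standardD _ hU R.
Let SM := @standardM _ hU R.
Let SN := @standardN _ hU R.
Let SV := @standardV _ hU R.

(* The supremum replaces a recursion of infinite length: a step of size more than [mu]
  taken within [mu] of it would pass it. *)
Lemma long_steps (P : R -> Prop) (a b mu : R) :
  definable Separation (fun e => P (toR R (e 0%N))) ->
  P a -> 0 < mu ->
  (forall t, P t -> t < b -> exists2 t', P t' & mu < t' - t) ->
  exists2 t, P t & b <= t.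
Proof.
move=> dP Pa mu0 step; apply: contrapT => nex.
have Pb t : P t -> t < b.
  by move=> Pt; rewrite ltNge; apply/negP => bt; apply: nex; exists t.
have [||s [sub slb]] := @ex_supremum _ hU R P dP.
- by exists a.
- by exists b => t /Pb /ltW.
have : s <= s - mu; last by lra.
apply: slb => t Pt; have [t' Pt' tt'] := step t Pt (Pb t Pt).
by have := sub t' Pt'; lra.
Qed.

Variables (x0 F x : U) (I : set R).
Local Notation X t := (component R (ap x (inR t))).
Local Notation Fc t v := (component R (ap F (opair (inR t) v))).

Hypothesis F_st : st F.
Hypothesis F_vec : forall t v, 0 <= t -> vec v -> vec (ap F (opair (inR t) v)).
Hypothesis F_cont : forall t v, 0 <= t -> vec v -> forall e : R, 0 < e ->
  exists2 h : R, 0 < h & forall t' v', 0 <= t' -> vec v' -> `|t' - t| < h ->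
    (forall i, i ∈ d -> `|component R v' i - component R v i| < h) ->
    forall i, i ∈ d -> `|Fc t' v' i - Fc t v i| < e.

Hypothesis I_dom : forall t, I t <-> exists v, opair (inR t) v ∈ x.
Hypothesis x_vec : forall t, I t -> vec (ap x (inR t)).

Definition bounded_at t : Prop :=
  exists e : R, [/\ standard e, 0 < e & forall i, i ∈ d -> `|X t i| <= e].

Definition reached t : Prop :=
  0 <= t /\ forall s, 0 <= s <= t -> I s /\ bounded_at s.

Variable mu : R.
Hypothesis mu_gt0 : 0 < mu.
Hypothesis strobe : forall t, limited t -> reached t ->
  exists t', [/\ mu < t' - t, infinitesimal (t' - t),
    forall s, t <= s <= t' ->
      I s /\ forall i, i ∈ d -> infinitesimal (X s i - X t i) &
    forall e, standard e -> 0 < e -> forall i, i ∈ d ->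
      `|X t' i - X t i - (t' - t) * Fc t (ap x (inR t)) i| <= e * (t' - t)].

Lemma definable_I (f : (nat -> U) -> R) : term Separation (fun e => inR (f e)) ->
  definable Separation (fun e => I (f e)).
Proof.
move=> tf; apply: (definable_iff (fun e => iff_sym (I_dom (f e)))).
definability hU R.
exact: (term_rename S tf).
Qed.

(* [h] and [eta] do not depend on [t1], which need not be standard: t1 = t0 gives the
  right derivative of the shadow of x, t1 < t0 the left one. *)
Lemma local_step (t0 : R) (v0 : U) (eps : R) :
  standard t0 -> 0 <= t0 -> st v0 -> vec v0 -> standard eps -> 0 < eps ->
  exists h eta : R, [/\ standard h, 0 < h, standard eta, 0 < eta &
    forall t1, `|t1 - t0| < h -> reached t1 ->
    (forall i, i ∈ d -> `|X t1 i - component R v0 i| < h) ->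
    forall t, t1 <= t <= t1 + eta -> [/\ I t, bounded_at t &
      forall lam, standard lam -> 0 < lam -> forall i, i ∈ d ->
      `|X t i - X t1 i - (t - t1) * Fc t0 v0 i| <= eps * (t - t1) + lam]].
Proof.
move=> st_t0 t0_ge0 st_v0 vv0 seps eps0.
have z := standard0 hU R; have mu0 := mu_gt0.
have [e2 [se2 e20 e2E]] : exists e : R, [/\ standard e, 0 < e & eps = e + e].
  by exists (eps / 2%:R); split; [apply/SM/SV|lra|lra].
have [||hc [shc [hc0 hcP]]] := @st_exR _ hU R (fun h => 0 < h /\
    forall t' v', 0 <= t' -> vec v' -> `|t' - t0| < h ->
    (forall i, i ∈ d -> `|component R v' i - component R v0 i| < h) ->
    forall i, i ∈ d -> `|Fc t' v' i - Fc t0 v0 i| < e2).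
- by definability hU R; apply: (definable_vec hU) => //; definability hU R.
- by have [h h0 hP] := F_cont t0_ge0 vv0 e20; exists h.
set F0 := fun i => Fc t0 v0 i.
have [i0 i0d F0max] : exists2 i, i ∈ d & forall j, j ∈ d -> `|F0 j| <= `|F0 i|.
  by apply: (family_max hU hd hd_pos); rewrite /F0; definability hU R.
set B := `|F0 i0| in F0max.
have B0 : 0 <= B by exact: normr_ge0.
have sB : standard B.
  have sti0 := @st_index _ hU R _ hd hd_st _ i0d.
  by rewrite /B /F0; apply: (@st_term _ hU R); definability hU R.
pose k : R := 6%:R * (B + eps + 1).
have k0 : 0 < k by rewrite /k; lra.
pose h : R := hc / 3%:R; pose eta : R := hc / k.
have eta0 : 0 < eta by rewrite /eta divr_gt0.
have etak : eta * (6%:R * (B + eps + 1)) = hc by rewrite /eta divfK // gt_eqF.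
have [etaB eta_le] : eta * (B + eps) <= hc / 6%:R /\ eta <= hc / 6%:R.
  by have : 0 <= eta * (B + eps) by [apply: mulr_ge0; lra]; split; lra.
have seta : standard eta.
  by apply: SM => //; apply: SV; apply: SM; [|apply: SD (Sn 1); exact: SD].
have sh : standard h by apply/SM/SV.
have h0 : 0 < h by rewrite /h; lra.
have hE : 3%:R * h = hc by rewrite /h; lra.
have s6 : standard (hc / 6%:R) by apply/SM/SV.
have p6 : 0 < hc / 6%:R by lra.
clear etak k0; clearbody eta h.
exists h, eta; split=> // t1 t1t0 r1 X1.
have [t1_ge0 _] := r1.
have [M [sM M0 X1M]] : bounded_at t1.
  by have [_ /(_ t1)[]] := r1; first by rewrite t1_ge0 lexx.
(* The strobe points: there the error is at most [eps * (t - t1)], with no slack, so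
  that errors do not accumulate from one step to the next. *)
pose phi lam t := t1 <= t /\
  (forall i, i ∈ d -> `|X t i - X t1 i - (t - t1) * F0 i| <= eps * (t - t1)) /\
  forall s, t1 <= s <= t -> I s /\ forall i, i ∈ d ->
    `|X s i - X t1 i - (s - t1) * F0 i| <= eps * (s - t1) + lam.
have displacement lam s i : i ∈ d -> t1 <= s <= t1 + eta ->
    `|X s i - X t1 i - (s - t1) * F0 i| <= eps * (s - t1) + lam ->
    `|X s i - X t1 i| <= hc / 6%:R + lam.
  move=> id' /andP[s1 s2] H.
  have H1 : `|(s - t1) * F0 i| <= (s - t1) * B.
    by rewrite normrM ger0_norm ?subr_ge0 // ler_wpM2l ?subr_ge0 ?F0max.
  have H2 : (s - t1) * (B + eps) <= eta * (B + eps) by apply: ler_wpM2r; lra.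
  have := ler_normD (X s i - X t1 i - (s - t1) * F0 i) ((s - t1) * F0 i).
  by rewrite subrK; lra.
have bounded lam s : standard lam -> 0 <= lam -> t1 <= s <= t1 + eta ->
    (forall i, i ∈ d ->
      `|X s i - X t1 i - (s - t1) * F0 i| <= eps * (s - t1) + lam) ->
    bounded_at s.
  move=> slam lam0 s1 H; exists (M + (hc / 6%:R + lam)); split.
  - by apply: SD => //; exact: SD.
  - by lra.
  move=> i id'; have := displacement _ _ _ id' s1 (H i id').
  by have := X1M i id'; have := ler_normD (X s i - X t1 i) (X t1 i); rewrite subrK; lra.
have extend lam t : standard lam -> 0 <= lam -> phi lam t -> t <= t1 + eta -> reached t.
  move=> slam lam0 [t1t [_ phiP]] tle; split; first lra.
  move=> s /andP[s0 st]; have [s1|s1] := leP s t1.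
    by apply: r1.2; rewrite s0.
  have s1t : t1 <= s <= t by rewrite st ltW.
  have [Is H] := phiP s s1t; split=> //; apply: (bounded lam) => //.
  by rewrite (ltW s1) /=; lra.
have step lam t : standard lam -> 0 < lam -> lam <= hc / 6%:R -> phi lam t ->
    t < t1 + eta -> exists2 t', phi lam t' & mu < t' - t.
  move=> slam lam0 lamh phit tlt; have [t1t [phi1 phi2]] := phit.
  have rt : reached t by apply: (extend lam) => //; exact: ltW.
  have It : I t by apply: (rt.2 t _).1; rewrite rt.1 lexx.
  have ltd : limited t.
    apply: (@limited_le U R (t0 + h + eta)); last first.
      by apply: limited_standard => //; apply: SD => //; exact: SD.
    by move: t1t0; rewrite ltr_norml => /andP[? ?]; rewrite !ger0_norm; lra.
  have [t' [mut' tt' near slope]] := strobe ltd rt.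
  have t't : 0 < t' - t by apply: lt_trans mut'.
  have Ftt0 i : i ∈ d -> `|Fc t (ap x (inR t)) i - F0 i| < e2.
    apply: hcP; [exact: rt.1|exact: x_vec| |].
    - by move: t1t0; rewrite !ltr_norml => /andP[? ?]; apply/andP; split; lra.
    move=> j jd; have t1tt : t1 <= t <= t1 + eta by rewrite t1t ltW.
    have Xd := displacement lam t j jd t1tt ((phi2 t _).2 j jd).
    have := ler_normD (X t j - X t1 j) (X t1 j - component R v0 j).
    by rewrite addrA subrK; have := X1 j jd; have := Xd _; lra.
  exists t' => //; split; [|split].
    by rewrite (le_trans t1t) // -subr_ge0 ltW.
    move=> i id'; have H1 := slope _ se2 e20 i id'.
    have H2 : `|(t' - t) * (Fc t (ap x (inR t)) i - F0 i)| <= (t' - t) * e2.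
      by rewrite normrM gtr0_norm // ler_wpM2l ?(ltW t't) // ltW // Ftt0.
    have H3 := phi1 i id'.
    have -> : X t' i - X t1 i - (t' - t1) * F0 i =
      (X t' i - X t i - (t' - t) * Fc t (ap x (inR t)) i) +
      (t' - t) * (Fc t (ap x (inR t)) i - F0 i) +
      (X t i - X t1 i - (t - t1) * F0 i) by ring.
    have -> : eps * (t' - t1) = e2 * (t' - t) + (t' - t) * e2 + eps * (t - t1).
      by rewrite e2E; ring.
    apply: le_trans (ler_normD _ _) (lerD _ H3).
    exact: le_trans (ler_normD _ _) (lerD H1 H2).
  move=> s /andP[s1 s2]; have [st|ts] := leP s t.
    by apply: phi2; rewrite s1.
  have [|Is nearX] := near s; first by rewrite s2 ltW.
  split=> // i id'.
  have H1 : `|X s i - X t i| < lam / 2%:R.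
    by apply: nearX => //; [exact/SM/SV|lra].
  have ist : infinitesimal ((s - t) * B).
    apply: (infinitesimalM hU) => //; apply: infinitesimal_le tt'.
    have ts' := ltW ts.
    by rewrite (gtr0_norm t't) ger0_norm ?subr_ge0 // lerD2r.
  have H2 : `|(s - t) * F0 i| < lam / 2%:R.
    apply: le_lt_trans (ist (lam / 2%:R) _ _); [|exact/SM/SV|lra].
    by rewrite !normrM (ger0_norm B0); apply: ler_wpM2l (F0max i id').
  have H3 := phi1 i id'.
  have H4 : eps * (t - t1) <= eps * (s - t1) by rewrite ler_pM2l // lerD2r ltW.
  have -> : X s i - X t1 i - (s - t1) * F0 i = (X t i - X t1 i - (t - t1) * F0 i) +
    (X s i - X t i) - (s - t) * F0 i by ring.
  have := ler_normB ((X t i - X t1 i - (t - t1) * F0 i) + (X s i - X t i))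
    ((s - t) * F0 i).
  have := ler_normD (X t i - X t1 i - (t - t1) * F0 i) (X s i - X t i).
  by lra.
have reach lam : standard lam -> 0 < lam -> lam <= hc / 6%:R ->
    exists2 t, phi lam t & t1 + eta <= t.
  move=> slam lam0 lamh; apply: (@long_steps (phi lam) t1 (t1 + eta) mu) => //.
  - by rewrite /phi /F0; definability hU R; apply: definable_I; definability hU R.
  - split; first exact: lexx.
    split=> [i id'|s /andP[s1 s2]]; first by rewrite !subrr mul0r subr0 normr0 mulr0.
    have -> : s = t1 by apply/le_anti; rewrite s1 s2.
    split; first by apply: (r1.2 t1 _).1; rewrite t1_ge0 lexx.
    by move=> i id'; rewrite !subrr mul0r subr0 normr0 mulr0 add0r ltW.
  - by move=> t; apply: step.
move=> t /andP[tge tle].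
have small lam : standard lam -> 0 < lam -> lam <= hc / 6%:R ->
    I t /\ forall i, i ∈ d -> `|X t i - X t1 i - (t - t1) * F0 i| <= eps * (t - t1) + lam.
  move=> slam lam0 lamh; have [t' [_ [_ H]] t't] := reach lam slam lam0 lamh.
  by apply: H; rewrite tge; lra.
have [It Xt] := small _ s6 p6 (lexx _).
split=> //.
  by apply: bounded Xt => //; [exact: ltW|rewrite tge].
move=> lam slam lam0 i id'.
have [lh|hl] := leP lam (hc / 6%:R); first exact: (small lam slam lam0 lh).2.
by have := Xt i id'; rewrite /F0; lra.
Qed.

Hypothesis x0_st : st x0.
Hypothesis x0_vec : vec x0.
Hypothesis I0 : I 0.
Hypothesis x_init : forall i, i ∈ d -> infinitesimal (X 0 i - component R x0 i).

Hypothesis F_app : forall t v, 0 <= t -> vec v ->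
  app F (opair (inR t) v) = ap F (opair (inR t) v).

Lemma reached_le t s : reached t -> 0 <= s <= t -> reached s.
Proof.
move=> [t0 rt] /andP[s0 st]; split=> // r /andP[r0 rs].
by apply: rt; rewrite r0 (le_trans rs).
Qed.

Lemma reached_self t : reached t -> I t /\ bounded_at t.
Proof. by move=> [t0 rt]; apply: rt; rewrite t0 lexx. Qed.

Lemma reached_extend t eta : reached t ->
  (forall s, t <= s <= t + eta -> I s /\ bounded_at s) ->
  forall s, t <= s <= t + eta -> reached s.
Proof.
move=> [t0 rt] H s /andP[ts se]; split=> [|r /andP[r0 rs]]; first exact: le_trans ts.
have [rt'|tr] := leP r t; first by apply: rt; rewrite r0.
by apply: H; rewrite (ltW tr) (le_trans rs).
Qed.

Lemma bounded_limited t i : bounded_at t -> i ∈ d -> limited (X t i).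
Proof. by move=> [e [se e0 H]] id'; exists e; split=> //; apply: H. Qed.

Lemma standard_field t v i : standard t -> st v -> i ∈ d -> standard (Fc t v i).
Proof.
move=> stt stv id'; have sti := @st_index _ hU R _ hd hd_st _ id'.
by apply: (@st_term _ hU R); definability hU R.
Qed.

Lemma standard_abs (a : R) : standard a -> standard `|a|.
Proof. by move=> sa; apply: (@st_term _ hU R); definability hU R. Qed.

Lemma standard_min (a b : R) : standard a -> standard b -> standard (Num.min a b).
Proof. by move=> sa sb; rewrite minEle; case: ifP. Qed.

Lemma standard_part_ge0 (a b : R) :
  standard a -> infinitesimal (b - a) -> 0 <= b -> 0 <= a.
Proof.
move=> sa iba b0; rewrite leNgt; apply/negP => a0.
have := iba (- a) (SN sa); rewrite oppr_gt0 => /(_ a0).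
by rewrite ltr_norml => /andP[]; lra.
Qed.

Lemma s_continuity t t1 : limited t -> reached t -> 0 <= t1 <= t ->
  infinitesimal (t - t1) -> forall i, i ∈ d -> infinitesimal (X t i - X t1 i).
Proof.
move=> lt rt t1t itt1 i id' e se e0.
have r1 := reached_le rt t1t; have /andP[t1_ge0 t1le] := t1t.
have [I1 b1] := reached_self r1.
have lt1 : limited t1.
  by apply: limited_le lt; rewrite !ger0_norm //; apply: le_trans t1le.
have [t0 [st0 it0]] := standard_part hU lt1.
have t0_ge0 := standard_part_ge0 st0 it0 t1_ge0.
have [||v0 [stv0 vv0 iv0]] := @standard_part_vec _ hU R _ hd hd_st (ap x (inR t1)).
- exact: x_vec.
- by move=> j jd; apply: bounded_limited.
have [h [eta [sh h0 seta eta0 H]]] := local_step st0 t0_ge0 stv0 vv0 (Sn 1) ltr01.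
have tle : t1 <= t <= t1 + eta.
  by have := itt1 _ seta eta0; rewrite ger0_norm ?subr_ge0 // t1le /=; lra.
have [_ _] := H t1 (it0 _ sh h0) r1 (fun j jd => iv0 j jd _ sh h0) t tle.
have s4 : standard (e / 4%:R) by apply/SM/SV.
have e4 : 0 < e / 4%:R by lra.
move=> /(_ _ s4 e4 i id').
have : infinitesimal ((t - t1) * `|Fc t0 v0 i|).
  by apply: (infinitesimalM hU) => //; exact/standard_abs/standard_field.
move=> /(_ _ s4 e4); rewrite [`|(_ - _) * `|_| |]normrM normr_id -normrM => H1.
have := itt1 _ s4 e4; rewrite ger0_norm ?subr_ge0 // => H2 H3.
have := ler_normD (X t i - X t1 i - (t - t1) * Fc t0 v0 i) ((t - t1) * Fc t0 v0 i).
by rewrite subrK; lra.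
Qed.

Lemma ex_standard_graph_space : exists2 w, st w &
  forall t v, vec v -> opair (inR t) v ∈ w.
Proof.
have [||V [stV VP]] := @st_ex _ hU R (fun V => forall v, vec v -> v ∈ V).
- by definability hU R; apply: (definable_vec hU) => //; definability hU R.
- have [s sP] := ex_product hU d (Rset R).
  have [V VP] := power (IST_ZFC hU) s.
  exists V => v /(vecP R d) [vv _]; apply/VP => p /vv [i [a [id' ->]]].
  exact: sP id' _ (inU_Rset a).
have [w stw wP] := ex_standard_product hU R (Rset_st R) stV.
by exists w => // t v vv; apply: wP; [exact: inU_Rset|exact: VP].
Qed.

Lemma ex_shadow : exists z, [/\ st z,
  forall p, p ∈ z -> exists t, exists v, [/\ 0 <= t, vec v & p = opair (inR t) v] &
  forall t v, standard t -> st v -> (opair (inR t) v ∈ z <->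
    [/\ vec v, reached t &
        forall i, i ∈ d -> infinitesimal (X t i - component R v i)])].
Proof.
have zero := standard0 hU R.
have [w stw wP] := ex_standard_graph_space.
have [|z [stz zP]] := @standardize _ hU (fun p => exists t, exists v,
    p = opair (inR t) v /\ [/\ vec v,
      0 <= t /\ (forall s, 0 <= s <= t -> (exists v', opair (inR s) v' ∈ x) /\
      exists e : R, [/\ standard e, 0 < e & forall i, i ∈ d -> `|X s i| <= e]) &
      forall i, i ∈ d -> forall e : R, standard e -> 0 < e ->
        `|X t i - component R v i| < e]) w stw.
  by definability hU R; apply: (definable_vec hU) => //; definability hU R.
exists z; split=> // [|t v stt stv].
  apply: (transfer_all hU).
    by definability hU R; apply: (definable_vec hU) => //; definability hU R.
  move=> p stp /(zP p stp) [_ [t [v [-> [vv [t0 _] _]]]]].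
  by exists t, v.
rewrite zP; last exact: (st_opair hU R).
split=> [[_ [t' [v' [/(opair_inj hU) [/(inU_inj (r:=R)) <- <-] [vv [t0 rt] Xv]]]]]|].
  split=> //; split=> // s /rt [Is bs]; split=> //; exact/I_dom.
move=> [vv [t0 rt] Xv]; split; first exact: wP.
by exists t, v; split=> //; split=> //; split=> // s /rt [/I_dom Is bs]; split.
Qed.

Lemma solution_continuous J y T : solution d F x0 J y -> J T -> forall e : R, 0 < e ->
  exists2 h : R, 0 < h & forall s, J s -> `|s - T| < h -> forall i, i ∈ d ->
    `|component R (ap y (inR s)) i - component R (ap y (inR T)) i| < e.
Proof.
move=> [[_ J0 _ _] yf _ yd] JT e e0.
have apy t : J t -> app y (inR t) = ap y (inR t).
  by move=> Jt; apply: (app_ap hU yf); exists t.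
have y_vec t : J t -> vec (ap y (inR t)).
  by move=> Jt; have [] := is_function_ap hU yf (ex_intro2 _ _ t Jt erefl).
have [h h0 H] := yd T JT 1 ltr01.
have [i0 i0d] : exists2 i, i ∈ d & forall j, j ∈ d ->
    `|Fc T (ap y (inR T)) j| <= `|Fc T (ap y (inR T)) i|.
  by apply: (family_max hU hd hd_pos); definability hU R.
set C := `|Fc T _ i0| => imax; have C0 : 0 <= C by exact: normr_ge0.
have q0 : 0 < e / (C + 1) by rewrite divr_gt0 //; lra.
exists (Num.min h (e / (C + 1))); first by rewrite lt_min h0.
move=> s Js; rewrite lt_min ltr_pdivlMr; last by lra.
move=> /andP[sh se] i id'.
have [->|sT] := eqVneq s T; first by rewrite subrr normr0.
have yTv := y_vec T JT; have T0 := J0 T JT.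
have := H s Js sT sh; rewrite apy // /app2 F_app //.
move=> /(slope_dist_lt hU hd hd_pos _ (y_vec _ JT) (y_vec _ Js) (F_vec T0 yTv)
  (apy _ JT) (apy _ Js) sT) /(_ i id'); rewrite mul1r => H1.
have H2 : `|(s - T) * Fc T (ap y (inR T)) i| <= `|s - T| * C.
  by rewrite normrM; apply: ler_wpM2l => //; exact: imax.
have := ler_normD (component R (ap y (inR s)) i - component R (ap y (inR T)) i -
  (s - T) * Fc T (ap y (inR T)) i) ((s - T) * Fc T (ap y (inR T)) i).
by rewrite subrK; lra.
Qed.

Section Solution.
Variable z : U.
Hypothesis z_st : st z.
Hypothesis z_graph : forall p, p ∈ z ->
  exists t, exists v, [/\ 0 <= t, vec v & p = opair (inR t) v].
Hypothesis z_shadow : forall t v, standard t -> st v -> (opair (inR t) v ∈ z <->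
  [/\ vec v, reached t &
      forall i, i ∈ d -> infinitesimal (X t i - component R v i)]).
Local Notation Z t := (component R (ap z (inR t))).

Definition z_dom : set R := [set t | exists v, opair (inR t) v ∈ z].

Lemma definable_z_dom m (f : (nat -> U) -> R) : (m = Transfer -> st z) ->
  term m (fun e => inR (f e)) -> definable m (fun e => z_dom (f e)).
Proof.
move=> stz tf; have az : admissible m z by case: m stz {tf} => // /(_ erefl).
by rewrite /z_dom /=; definability hU R; exact: (term_rename S tf).
Qed.

Lemma z_dom_reached t : standard t -> z_dom t <-> reached t.
Proof.
move=> stt; split=> [zt|rt].
  have [|v [stv]] := @st_ex _ hU R (fun v => opair (inR t) v ∈ z) _ zt.
    by definability hU R.
  by move=> /(z_shadow stt stv) [].
have [It bt] := reached_self rt.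
have [||v [stv vv Xv]] := @standard_part_vec _ hU R _ hd hd_st (ap x (inR t)).
- exact: x_vec.
- by move=> j jd; apply: bounded_limited.
by exists v; apply/z_shadow.
Qed.

Lemma z_functional t v v' :
  opair (inR t) v ∈ z -> opair (inR t) v' ∈ z -> v = v'.
Proof.
move: t v v'; apply: (transferR hU); first by definability hU R.
move=> t stt; apply: (transfer_all hU); first by definability hU R.
move=> v stv; apply: (transfer_all hU); first by definability hU R.
move=> v' stv' /(z_shadow stt stv) [vv _ Xv] /(z_shadow stt stv') [vv' _ Xv'].
apply: (vec_ext hU vv vv') => i id'; apply/eqP; rewrite -subr_eq0; apply/eqP.
apply: (standard_infinitesimal hU).
  by apply: SD; [|apply: SN]; exact: (standard_component hU R hd hd_st).
exact: (infinitesimal_sub hU (infinitesimal_subC (Xv i id')) (Xv' i id')).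
Qed.

Lemma z_is_function : is_function (inR @` z_dom) vec z.
Proof.
split=> [p pz|_ [t [v vz] <-]].
  have [t [v [_ vv pE]]] := z_graph pz.
  exists (inR t), v; split=> //; exists t => //; exists v.
  by rewrite -pE.
by exists v; split=> // v'; apply: z_functional.
Qed.

Lemma z_dom_ge0 t : z_dom t -> 0 <= t.
Proof.
move=> [v /z_graph [t' [v' [t0 _]]]].
by move=> /(opair_inj hU) [/(inU_inj (r:=R)) ->].
Qed.

Lemma z_dom_le t s : z_dom t -> 0 <= s <= t -> z_dom s.
Proof.
have zero := standard0 hU R.
move: t s; apply: (transferR hU).
  by definability hU R; apply: definable_z_dom => //; definability hU R.
move=> t stt; apply: (transferR hU).
  by definability hU R; apply: definable_z_dom => //; definability hU R.
move=> s sts /(z_dom_reached stt) rt st; apply/(z_dom_reached sts).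
exact: reached_le rt st.
Qed.

Lemma z_value t : standard t -> z_dom t -> [/\ st (ap z (inR t)), vec (ap z (inR t)),
  reached t & forall i, i ∈ d -> infinitesimal (X t i - Z t i)].
Proof.
move=> stt zt; have stz : st (ap z (inR t)).
  by apply: (@st_term _ hU R); definability hU R.
have zt' : (inR @` z_dom) (inR t) by exists t.
have [_ /(_ (ap z (inR t))) E] := is_function_ap hU z_is_function zt'.
by have /(z_shadow stt stz) [] := E.2 erefl.
Qed.

Lemma z_vec t : z_dom t -> vec (ap z (inR t)).
Proof.
by move=> zt; have [] := is_function_ap hU z_is_function (ex_intro2 _ _ t zt erefl).
Qed.

Lemma reached0 : reached 0.
Proof.
split=> [|s /andP[s0 s1]]; first exact: lexx.
have -> : s = 0 by apply/le_anti; rewrite s0 s1.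
split=> //.
have [i0 i0d imax] : exists2 i, i ∈ d & forall j, j ∈ d ->
    `|component R x0 j| <= `|component R x0 i|.
  by apply: (family_max hU hd hd_pos); definability hU R.
have [e [se e0 H]] : limited (component R x0 i0).
  exact/(limited_standard hU)/(standard_component hU R hd hd_st).
exists (e + 1); split; [exact: SD (Sn 1)|lra|move=> i id'].
have := x_init id' (Sn 1) ltr01; have := imax i id'.
by have := ler_normD (X 0 i - component R x0 i) (component R x0 i); rewrite subrK; lra.
Qed.

Lemma z_dom0 : z_dom 0.
Proof. exact/(z_dom_reached (standard0 hU R))/reached0. Qed.

Lemma z_init : ap z (inR 0) = x0.
Proof.
have := (is_function_ap hU z_is_function (ex_intro2 _ _ 0 z_dom0 erefl)).2 x0.
move=> /iffLR -> //; apply/z_shadow => //; first exact: standard0.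
by split=> //; exact: reached0.
Qed.

Lemma z_dom_extend t : standard t -> z_dom t ->
  exists eta, [/\ standard eta, 0 < eta & z_dom (t + eta)].
Proof.
move=> stt zt; have [stz vz rt Xz] := z_value stt zt.
have [h [eta [sh h0 seta eta0 H]]] := local_step stt rt.1 stz vz (Sn 1) ltr01.
exists eta; split=> //; apply/z_dom_reached; first exact: SD.
apply: (reached_extend (eta := eta) rt); last by rewrite lexx andbT; lra.
move=> s st; have [||Is bs _] := H t _ rt _ s st => //.
  by rewrite subrr normr0.
by move=> i id'; apply: Xz.
Qed.

Lemma near_estimate (a b a' b' c e : R) :
  infinitesimal (a - a') -> infinitesimal (b - b') ->
  (forall lam, standard lam -> 0 < lam -> `|a - b - c| <= e + lam) ->
  standard a' -> standard b' -> standard c -> standard e ->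
  `|a' - b' - c| <= e.
Proof.
move=> iaa ibb H sa sb sc se; rewrite leNgt; apply/negP => lt.
pose g := `|a' - b' - c| - e.
have sg : standard (g / 4%:R).
  have sc' : standard (a' - b' - c) by exact: SD (SD sa (SN sb)) (SN sc).
  exact: SM (SD (standard_abs sc') (SN se)) (SV (Sn 4)).
have g0 : 0 < g / 4%:R by rewrite /g; lra.
have := iaa _ sg g0; have := ibb _ sg g0; have := H _ sg g0.
have := ler_normB (a - b - c) (a - a').
have := ler_normD (a - b - c - (a - a')) (b - b').
have -> : a - b - c - (a - a') + (b - b') = a' - b' - c by ring.
by rewrite /g; lra.
Qed.

Lemma z_derivative t : standard t -> z_dom t -> forall e, standard e -> 0 < e ->
  exists2 h, standard h & 0 < h /\ forall s, standard s -> z_dom s -> `|s - t| < h ->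
  forall i, i ∈ d ->
    `|Z s i - Z t i - (s - t) * Fc t (ap z (inR t)) i| <= e * `|s - t|.
Proof.
move=> stt zt e se e0; have [stz vz rt Xz] := z_value stt zt.
have [h [eta [sh h0 seta eta0 H]]] := local_step stt rt.1 stz vz se e0.
have sh2 : standard (h / 2%:R) by exact/SM/SV.
have h20 : 0 < h / 2%:R by lra.
have [imu mu0] : infinitesimal mu /\ 0 < mu.
  split; last exact: mu_gt0.
  have l0 : limited (0 : R) by apply/(limited_standard hU)/standard0.
  have [t' [mut' it' _ _]] := strobe l0 reached0.
  have mu0 := mu_gt0; apply: infinitesimal_le it'.
  by rewrite !gtr0_norm //; lra.
have [|||del [sdel del0 Pdel]] := @underspill _ hU R (fun del => forall s,
    0 <= s -> t - del <= s -> s <= t -> forall i, i ∈ d ->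
    `|X t i - X s i| < h / 2%:R) mu _ _ mu0 imu.
- by definability hU R.
- by move=> a b b0 ba Pa s s0 bs; apply: Pa => //; lra.
- move=> a a0 ia s s0 as' st i id'.
  apply: s_continuity => //; first exact: limited_standard.
    by rewrite s0.
  by apply: infinitesimal_le ia; rewrite !ger0_norm //; lra.
have stc := standard_component hU R hd hd_st.
exists (Num.min h (Num.min eta del)); first by do 2?apply: standard_min.
split=> [|s sts zs]; first by rewrite !lt_min h0 eta0.
rewrite !lt_min => /and3P[sth ste std] i id'.
have [stzs vzs rs Xzs] := z_value sts zs.
have [st|ts] := leP s t.
- rewrite [`|s - t|]ler0_norm ?subr_le0 // opprB.
  have -> : Z s i - Z t i - (s - t) * Fc t (ap z (inR t)) i =
    - (Z t i - Z s i - (t - s) * Fc t (ap z (inR t)) i) by ring.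
  rewrite normrN.
  move: ste std; rewrite distrC ger0_norm ?subr_ge0 // => ste std.
  apply: (near_estimate (Xz i id') (Xzs i id')) => //; first last.
  + by apply: SM => //; apply: SD => //; exact: SN.
  + by apply: SM; [apply: SD => //; exact: SN|exact: standard_field].
  + exact: stc.
  + exact: stc.
  have [||_ _ Hlam] := H s sth rs _ t; last by move=> lam slam lam0; exact: Hlam.
  + move=> j jd; have ds : t - del <= s by lra.
    have := Pdel s rs.1 ds st j jd; have := Xz j jd _ sh2 h20.
    have := ler_normB (X t j - Z t j) (X t j - X s j).
    have -> : X t j - Z t j - (X t j - X s j) = X s j - Z t j by ring.
    by move=> *; lra.
  + by rewrite st /=; lra.
- have st0 : 0 <= s - t by lra.
  move: sth ste std; rewrite (ger0_norm st0) => sth ste std.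
  apply: (near_estimate (Xzs i id') (Xz i id')) => //; first last.
  + by apply: SM => //; apply: SD => //; exact: SN.
  + by apply: SM; [apply: SD => //; exact: SN|exact: standard_field].
  + exact: stc.
  + exact: stc.
  have [|||_ _ Hlam] := H t _ rt _ s; last by move=> lam slam lam0; exact: Hlam.
  + by rewrite subrr normr0.
  + by move=> j jd; apply: Xz.
  + by rewrite ltW //=; lra.
Qed.

Lemma z_derivative_all t : z_dom t -> forall e : R, 0 < e ->
  exists2 h : R, 0 < h & forall s, z_dom s -> `|s - t| < h -> forall i, i ∈ d ->
    `|Z s i - Z t i - (s - t) * Fc t (ap z (inR t)) i| <= e * `|s - t|.
Proof.
have zero := standard0 hU R.
move: t; apply: (transferR hU).
  by definability hU R; apply: definable_z_dom => //; definability hU R.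
move=> t stt zt; apply: (transferR hU).
  by definability hU R; apply: definable_z_dom => //; definability hU R.
move=> e se e0; have [h sh [h0 H]] := z_derivative stt zt se e0.
exists h => //; apply: (transferR hU).
  by definability hU R; apply: definable_z_dom => //; definability hU R.
by move=> s sts zs sth i id'; apply: H.
Qed.

Lemma z_solution : solution d F x0 z_dom z.
Proof.
have zf := z_is_function.
have apz t : z_dom t -> app z (inR t) = ap z (inR t).
  by move=> zt; apply: (app_ap hU zf); exists t.
split=> //.
- split; [exact: z_dom0|exact: z_dom_ge0| |].
    have [eta [_ eta0]] := z_dom_extend (standard0 hU R) z_dom0.
    by rewrite add0r; exists eta.
  move=> a b c /z_dom_ge0 a0 zc /andP[ab bc]; apply: z_dom_le zc _.
  by rewrite bc (le_trans a0).
- by rewrite apz; [exact: z_init|exact: z_dom0].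
move=> t zt e e0.
have e20 : 0 < e / 2%:R by lra.
have [h h0 H] := z_derivative_all zt e20; exists h => // s zs st sth.
have t0 := z_dom_ge0 zt.
rewrite apz // /app2 F_app //; last exact: z_vec.
apply/(slope_dist_lt hU hd hd_pos); rewrite ?apz //; try exact: z_vec.
  by apply: F_vec => //; exact: z_vec.
move=> i id'; apply: le_lt_trans (H s zs sth i id') _.
by rewrite ltr_pM2r ?normr_gt0 ?subr_eq0 //; lra.
Qed.

Lemma z_continuous t : z_dom t -> standard t ->
  forall s, z_dom s -> infinitesimal (s - t) -> forall i, i ∈ d -> infinitesimal (Z s i - Z t i).
Proof.
move=> zt stt s zs ist i id'.
have [stz vz rt Xz] := z_value stt zt.
have [h sh [h0 H]] := z_derivative stt zt (Sn 1) ltr01.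
have /(_ s zs (ist h sh h0) i id') : forall s, z_dom s -> `|s - t| < h ->
    forall i, i ∈ d ->
    `|Z s i - Z t i - (s - t) * Fc t (ap z (inR t)) i| <= 1 * `|s - t|.
  have s1 := standard1 hU R; apply: (transferR hU) H.
  by definability hU R; apply: definable_z_dom => //; definability hU R.
rewrite mul1r => H1; have sF := standard_field stt stz id'.
have iF : infinitesimal ((s - t) * `|Fc t (ap z (inR t)) i|).
  by apply: (infinitesimalM hU) => //; exact: standard_abs.
have H2 : infinitesimal (Z s i - Z t i - (s - t) * Fc t (ap z (inR t)) i).
  exact: (infinitesimal_le H1).
have H3 : infinitesimal ((s - t) * Fc t (ap z (inR t)) i).
  by apply: infinitesimal_le iF; rewrite !normrM normr_id.
by rewrite -[Z s i - _](subrK ((s - t) * Fc t (ap z (inR t)) i)); exact: infinitesimalD.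
Qed.

Variables (J : set R) (y : U).
Hypothesis y_solution : solution d F x0 J y.
Hypothesis y_unique : forall D' y', solution d F x0 D' y' -> restricts D' y' J y.

Lemma z_restricts t : z_dom t -> J t /\ ap z (inR t) = ap y (inR t).
Proof.
move=> zt; have [DJ E] := y_unique z_solution.
have [_ yf _ _] := y_solution; split; first exact: DJ.
rewrite -(app_ap hU z_is_function); last by exists t.
by rewrite E // (app_ap hU yf) //; exists t => //; exact: DJ.
Qed.

Lemma z_dom_total L : standard L -> J L -> z_dom L.
Proof.
move=> sL JL; apply: contrapT => nzL.
have zero := standard0 hU R.
have [[J0 J_ge0 _ J_itv] yf _ _] := y_solution.
have L0 := J_ge0 L JL.
have zL s : z_dom s -> s <= L.
  move=> zs; rewrite leNgt; apply/negP => Ls; apply/nzL/(z_dom_le zs).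
  by rewrite L0 ltW.
have [||T [sT [Tsup Tlub]]] := @st_exR _ hU R (fun T =>
  (forall s, z_dom s -> s <= T) /\ forall b, (forall s, z_dom s -> s <= b) -> T <= b).
- by definability hU R; apply: definable_z_dom => //; definability hU R.
- apply: (ex_supremum hU); first by apply: definable_z_dom => //; definability hU R.
  + by exists 0; exact: z_dom0.
  + by exists L.
have TL : T <= L by apply: Tlub.
have T0 : 0 < T.
  have [eta [_ eta0 /Tsup]] := z_dom_extend zero z_dom0.
  by rewrite add0r; apply: lt_le_trans.
have nzT : ~ z_dom T.
  by move=> zT; have [eta [_ eta0 /Tsup]] := z_dom_extend sT zT; lra.
have below s : 0 <= s -> s < T -> z_dom s.
  move=> s0 sltT; apply: contrapT => nzs.
  have /Tlub : forall r, z_dom r -> r <= s; last by lra.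
  move=> r zr; rewrite leNgt; apply/negP => sr; apply/nzs/(z_dom_le zr).
  by rewrite s0 ltW.
have JT : J T by apply: (J_itv 0 T L) => //; rewrite (ltW T0).
have [||v [stv [vv v_lim]]] := @st_ex _ hU R (fun v => vec v /\ forall e : R, 0 < e ->
    exists2 h : R, 0 < h & forall s, z_dom s -> `|s - T| < h -> forall i, i ∈ d ->
    `|Z s i - component R v i| < e).
- by definability hU R; first [apply: (definable_vec hU)|apply: definable_z_dom] => //;
    definability hU R.
- exists (ap y (inR T)); split.
    by have [] := is_function_ap hU yf (ex_intro2 _ _ T JT erefl).
  move=> e e0; have [h h0 H] := solution_continuous y_solution JT e0.
  exists h => // s zs sh i id'; have [Js ->] := z_restricts zs.
  exact: H.
have [h [eta [sh h0 seta eta0 H]]] := local_step sT (ltW T0) stv vv (Sn 1) ltr01.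
have [e2 [se2 e20 hE]] : exists e : R, [/\ standard e, 0 < e & h = e + e].
  by exists (h / 2%:R); split; [apply/SM/SV|lra|lra].
have [||del [sdel [del0 Hdel]]] := @st_exR _ hU R (fun del => 0 < del /\
    forall s, z_dom s -> `|s - T| < del -> forall i, i ∈ d ->
    `|Z s i - component R v i| < e2).
- by definability hU R; apply: definable_z_dom => //; definability hU R.
- by have [del del0 Hdel] := v_lim e2 e20; exists del.
pose m : R := Num.min (Num.min del h) (Num.min eta T).
have [[m0 mdel] [mh [meta mT]]] : (0 < m /\ m <= del) /\ (m <= h /\ m <= eta /\ m <= T).
  by rewrite /m !lt_min !ge_min del0 h0 eta0 T0 !lexx !orbT.
have sm : standard m by do 3?apply: standard_min.
have [s ss sE] : exists2 s, standard s & s = T - m / 2%:R.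
  by exists (T - m / 2%:R) => //; apply: SD => //; apply: SN; exact/SM/SV.
have sT' : `|s - T| = m / 2%:R by rewrite distrC ger0_norm; lra.
have zs : z_dom s by apply: below; lra.
have [stzs vzs rs Xs] := z_value ss zs.
apply/nzT/z_dom_reached => //; apply: (reached_extend (eta := eta) rs); last first.
  by apply/andP; split; lra.
move=> r sr; have [||Ir br _] := H s _ rs _ r sr => //.
  by rewrite sT'; lra.
move=> i id'; have := Xs i id' e2 se2 e20.
have := Hdel s zs _ i id'; rewrite sT' => /(_ ltac:(lra)) H1 H2.
have := ler_normD (X s i - Z s i) (Z s i - component R v i).
by rewrite addrA subrK; lra.
Qed.

Lemma x_near_y L : standard L -> J L -> forall t, 0 <= t <= L ->
  [/\ I t, J t & forall i, i ∈ d ->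
    infinitesimal (X t i - component R (ap y (inR t)) i)].
Proof.
move=> sL JL t tL; have zL := z_dom_total sL JL.
have /(z_dom_reached sL) rL := zL.
have /andP[t0 tle] := tL; have zt := z_dom_le zL tL.
have rt := reached_le rL tL; have [It _] := reached_self rt.
have [Jt <-] := z_restricts zt; split=> // i id'.
have lt : limited t.
  apply: limited_le (limited_standard hU sL).
  by rewrite !ger0_norm // (le_trans t0).
have [r [sr itr]] := standard_part hU lt.
have r0 := standard_part_ge0 sr itr t0.
have rle : r <= L.
  rewrite -subr_ge0; apply: (@standard_part_ge0 _ (L - t)).
  - by apply: SD => //; exact: SN.
  - by rewrite (_ : L - t - (L - r) = r - t); [exact: infinitesimal_subC|ring].
  - by rewrite subr_ge0.
have zr : z_dom r by apply: z_dom_le zL _; rewrite r0.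
have [_ _ rr Xr] := z_value sr zr.
have lr := limited_standard hU sr.
apply: (infinitesimal_sub hU (y := Z r i)); last first.
  by apply: infinitesimal_subC; apply: z_continuous.
apply: (infinitesimal_sub hU (y := X r i)); last exact: Xr.
have [rlt|tlr] := leP r t.
  by apply: s_continuity => //; rewrite r0.
apply: infinitesimal_subC; apply: s_continuity => //; first by rewrite t0 ltW.
exact: infinitesimal_subC.
Qed.

End Solution.

Lemma x_near_solution J y : solution d F x0 J y ->
  (forall D' y', solution d F x0 D' y' -> restricts D' y' J y) ->
  forall L, standard L -> J L -> forall t, 0 <= t <= L ->
  [/\ I t, J t & forall i, i ∈ d ->
    infinitesimal (X t i - component R (ap y (inR t)) i)].
Proof.
move=> y_sol y_uniq; have [z [z_st z_graph z_shadow]] := ex_shadow.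
exact: (x_near_y z_st z_graph z_shadow y_sol y_uniq).
Qed.

End Strobing.

Theorem theorem3p3
  (U : universe) (hU : IST U) (R : real_system U)
  (d : U) (hd : is_nat d) (hd_st : st d) (hd_pos : exists i, i ∈ d)
  (x0 : U) (hx0 : vectors R d x0) (hx0_st : st x0)
  (F : U) (hF : is_field R d F) (hF_st : st F) (hF_cont : continuous_field R d F)
  (I : set R) (hI0 : I 0)
  (x : U) (hx : is_function (@inU U R @` I) (vectors R d) x)
  (hx_init : vnear R d (app x (inU (0 : R))) x0)
  (ha : stroboscopic d F I x)
  (y : U) (omega : \bar R) (homega : (0 < omega)%E)
  (J : set R) (hJ : J = [set t : R | 0 <= t /\ (t%:E < omega)%E])
  (hb : unique_solution d F x0 J y) :
  forall L : R, standard L -> J L ->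
    (forall t : R, 0 <= t <= L -> I t) /\
    (forall t : R, 0 <= t <= L -> vnear R d (app x (inU t)) (app y (inU t))).
Proof.
have I_dom t : I t <-> exists v, opair (@inU _ R t) v ∈ x.
  split=> [It|[v /hx.1 [_ [b [[s Is <-] _]]]]].
    by have [v [vx _]] := hx.2 _ (ex_intro2 _ _ t It erefl); exists v.
  by move=> /(opair_inj hU) [/(inU_inj (r:=R)) ->].
have x_app t : I t -> app x (@inU _ R t) = ap x (inU t).
  by move=> It; apply: (app_ap hU hx); exists t.
have x_vec t : I t -> vectors R d (ap x (@inU _ R t)).
  by move=> It; have [] := is_function_ap hU hx (ex_intro2 _ _ t It erefl).
have F_app t v : 0 <= t -> vectors R d v ->
    app F (opair (@inU _ R t) v) = ap F (opair (inU t) v).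
  by move=> t0 vv; apply: (app_ap hU hF); exists t, v.
have F_vec t v : 0 <= t -> vectors R d v -> vectors R d (ap F (opair (@inU _ R t) v)).
  move=> t0 vv.
  by have [] := is_function_ap hU hF (a := opair (inU t) v); [exists t, v|].
have F_cont t v : 0 <= t -> vectors R d v -> forall e : R, 0 < e ->
  exists2 h : R, 0 < h & forall t' v', 0 <= t' -> vectors R d v' -> `|t' - t| < h ->
    (forall i, i ∈ d -> `|component R v' i - component R v i| < h) ->
    forall i, i ∈ d -> `|component R (ap F (opair (inU t') v')) i -
      component R (ap F (opair (inU t) v)) i| < e.
  move=> t0 vv e e0; have [h h0 H] := hF_cont t v t0 vv e e0; exists h => //.
  move=> t' v' t'0 vv' tt' vv'h; apply/(dist_lt hU hd hd_pos); try exact: F_vec.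
  by rewrite -!F_app //; apply: H => //; apply/(dist_lt hU hd hd_pos).
have x_init i : i ∈ d ->
    infinitesimal (component R (ap x (@inU _ R 0)) i - component R x0 i).
  move: i; apply/(vnear_component hU hd hd_pos) => //; first exact: x_vec.
  by rewrite -x_app.
have [mu mu0 strobe] := ha.
have strobe' t : limited t -> reached d x I t -> exists t', [/\ mu < t' - t,
    infinitesimal (t' - t),
    forall s, t <= s <= t' -> I s /\ forall i, i ∈ d ->
      infinitesimal (component R (ap x (inU s)) i - component R (ap x (inU t)) i) &
    forall e : R, standard e -> 0 < e -> forall i, i ∈ d ->
      `|component R (ap x (inU t')) i - component R (ap x (inU t)) i -
        (t' - t) * component R (ap F (opair (inU t) (ap x (inU t)))) i|
      <= e * (t' - t)].
  move=> lt [t0 rt].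
  have [It _] := rt t ltac:(by rewrite t0 lexx).
  have [s st|t' It' [mut' tt' It't near slope]] :=
      strobe t lt t0 It (fun s st => (rt s st).1).
    have [Is bs] := rt s st.
    by rewrite x_app //; apply/(vlimited_component hU hd hd_pos) => //; exact: x_vec.
  exists t'; split=> // [s st|e se e0].
    have Is := It't s st; split=> //.
    apply/(vnear_component hU hd hd_pos); try exact: x_vec.
    by rewrite -!x_app //; exact: near.
  have t't : 0 < t' - t by exact: lt_trans mut'.
  have neq : t' != t by rewrite -subr_eq0 gt_eqF.
  have := le_lt_trans (ler_norm _) (slope e se e0).
  rewrite /app2 x_app // F_app //; last exact: x_vec.
  move/(slope_dist_lt hU hd hd_pos _ (x_vec _ It) (x_vec _ It')
    (F_vec _ _ t0 (x_vec _ It)) (x_app _ It) (x_app _ It') neq) => H i id'.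
  by rewrite -{2}(gtr0_norm t't); apply/ltW/H.
have [[y_sol _] _ y_uniq] := hb; have [_ yf _ _] := y_sol.
move=> L sL JL.
have near := x_near_solution hU hd hd_st hd_pos hF_st F_vec F_cont I_dom x_vec mu0
  strobe' hx0_st hx0 hI0 x_init F_app y_sol y_uniq sL JL.
split=> t tL; have [It Jt xy] := near t tL => //.
have yJ : (@inU _ R @` J) (inU t) by exists t.
rewrite x_app // (app_ap hU yf yJ); apply/(vnear_component hU hd hd_pos) => //.
  exact: x_vec.
by have [] := is_function_ap hU yf yJ.
Qed.
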